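(* Let $U=\{x\in\mathbb{R}^3:x_3>0\}$ and let $f\in C_0^{\infty}(B_{\epsilon_1,\epsilon_2}\cap U)$ for some $0<\epsilon_1<\epsilon_2<1$. Let $\epsilon_1\le\epsilon\le\epsilon_2$ and let $\delta=\frac{1-\epsilon^2}{2\epsilon}$. Then $\mathcal{S}f(r,\alpha,\beta)$ known for $0\le r\le\delta$ and for all $(\alpha,\beta)\in S^2$ determines $f$ uniquely for $\epsilon\le|x|\le1$. That is, if $f_1,f_2\in C_0^{\infty}(B_{\epsilon_1,\epsilon_2}\cap U)$ satisfy $\mathcal{S}f_1(r,\alpha,\beta)=\mathcal{S}f_2(r,\alpha,\beta)$ for all $0\le r\le\delta$ and $(\alpha,\beta)\in S^2$, then $f_1(x)=f_2(x)$ for all $\epsilon\le|x|\le1$.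
   Context: Hollow balls: $B_{a,b}=\{x\in\mathbb{R}^3: a<|x|<b\}$. $C_0^\infty(\Omega)$ denotes smooth real-valued functions with compact support in $\Omega$, extended by zero to $\mathbb{R}^3$. Polar form: $F(\rho,\theta,\varphi)=f(\rho\sin\varphi\cos\theta,\rho\sin\varphi\sin\theta,\rho\cos\varphi)$, with $\theta\in[0,2\pi]$ the azimuth and $\varphi\in[0,\pi]$ the colatitude. Rotations: $h=U(\alpha)V(\beta)\in \mathrm{SO}(3)$, where $U(\alpha)$ and $V(\beta)$ (matrices, not to be confused with the half space $U$) are the rotations about the $x_3$- and $x_2$-axis by angles $\alpha\in[0,2\pi]$, $\beta\in[0,\pi]$ respectively, so that $h(0,0,1)^T=(\sin\beta\cos\alpha,\sin\beta\sin\alpha,\cos\beta)^T$. The pair $(\alpha,\beta)$ is identified with this point of $S^2$. The action is $(h\cdot f)(x)=f(hx)$, and $h\cdot F$ is the polar form of $h\cdot f$. Spindle transform: for $r\ge0$ and $(\alpha,\beta)\in S^2$, $$\mathcal{S}f(r,\alpha,\beta)=\int_{0}^{2\pi}\int_{0}^{\pi}\rho^2\sin\varphi\sqrt{\frac{1+r^2}{1+r^2\sin^2\varphi}}\,(h\cdot F)(\rho,\theta,\varphi)\Big|_{\rho=\sqrt{r^2\sin^2\varphi+1}-r\sin\varphi}\mathrm{d}\varphi\,\mathrm{d}\theta,\qquad h=U(\alpha)V(\beta).$$ *)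

(* Defs.v *)
From HB Require Import structures.
From mathcomp Require Import all_boot all_order all_algebra.
From mathcomp Require Import all_classical all_reals all_analysis.

Set Implicit Arguments.
Unset Strict Implicit.
Unset Printing Implicit Defensive.

Import Order.TTheory GRing.Theory Num.Theory.
Import numFieldNormedType.Exports.

Local Open Scope classical_set_scope.
Local Open Scope ring_scope.

Section SpindleTransform.
Context {R : realType}.
Implicit Types (f : 'cV[R]_3 -> R) (x : 'cV[R]_3) (Omega : set 'cV[R]_3).

Definition vec3 (a b c : R) : 'cV[R]_3 := \col_(i < 3) [:: a; b; c]`_i.

(* The Euclidean norm; the library norm `|x| on matrices is the sup norm. *)
Definition enorm x : R := Num.sqrt (\sum_(i < 3) x i 0 ^+ 2).

Definition hollow_ball (a b : R) : set 'cV[R]_3 := [set x | a < enorm x < b].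

(* Coordinates are numbered from 0, so x_3 is the entry of index 2. *)
Definition upper_half_space : set 'cV[R]_3 := [set x | 0 < x 2%:R 0].

(* delta_mx i 0 is the i-th standard basis vector. *)
Fixpoint Ck (n : nat) f : Prop :=
  continuous f /\
  if n is m.+1 then
    forall i : 'I_3,
      (forall x, derivable f x (delta_mx i 0)) /\
      Ck m (fun x => 'D_(delta_mx i 0) f x)
  else True.

Definition smooth f : Prop := forall n, Ck n f.

Definition closed_support f : set 'cV[R]_3 := closure [set x | f x != 0].

(* Elements of C_0^oo(Omega) are represented by their extension by zero to the
   whole space, which is smooth there since the support is a compact subset of
   Omega. *)
Definition test_function Omega f : Prop :=
  [/\ smooth f, compact (closed_support f) & closed_support f `<=` Omega].

Definition polar_point (rho theta phi : R) : 'cV[R]_3 :=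
  vec3 (rho * sin phi * cos theta) (rho * sin phi * sin theta) (rho * cos phi).

Definition polar_form f (rho theta phi : R) : R := f (polar_point rho theta phi).

Definition mx3 (rows : seq (seq R)) : 'M[R]_3 :=
  \matrix_(i < 3, j < 3) (nth [::] rows i)`_j.

Definition rotU (alpha : R) : 'M[R]_3 :=
  mx3 [:: [:: cos alpha; - sin alpha; 0];
          [:: sin alpha;   cos alpha; 0];
          [:: 0;           0;         1]].

Definition rotV (beta : R) : 'M[R]_3 :=
  mx3 [:: [:: cos beta;   0; sin beta];
          [:: 0;          1; 0       ];
          [:: - sin beta; 0; cos beta]].

Definition rotation (alpha beta : R) : 'M[R]_3 := rotU alpha *m rotV beta.

(* Fixes the orientation conventions of rotU and rotV. *)
Lemma rotation_north_pole (alpha beta : R) :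
  rotation alpha beta *m vec3 0 0 1 = polar_point 1 alpha beta.
Proof.
rewrite /rotation -mulmxA; apply/colP => i.
rewrite !mxE !big_ord_recl big_ord0 !mxE !big_ord_recl !big_ord0 !mxE /=.
rewrite !(mulr0, mul0r, addr0, add0r, mulr1, mul1r).
case: i => [[|[|[|i]]] Hi] //=;
  by rewrite ?mul0r ?mul1r ?addr0 ?add0r // mulrC.
Qed.

Definition act (h : 'M[R]_3) f : 'cV[R]_3 -> R := fun x => f (h *m x).

Definition spindle_radius (r phi : R) : R :=
  Num.sqrt (r ^+ 2 * sin phi ^+ 2 + 1) - r * sin phi.

Definition spindle f (r alpha beta : R) : R :=
  \int[lebesgue_measure]_(theta in `[0, 2 * pi])
    \int[lebesgue_measure]_(phi in `[0, pi])
      (let rho := spindle_radius r phi in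
       rho ^+ 2 * sin phi
       * Num.sqrt ((1 + r ^+ 2) / (1 + r ^+ 2 * sin phi ^+ 2))
       * polar_form (act (rotation alpha beta) f) rho theta phi).

End SpindleTransform.

(* Main.v *)
Require Import Defs.
From mathcomp Require Import all_boot all_order all_algebra.
From mathcomp Require Import all_classical all_reals all_analysis.
From mathcomp Require Import ring lra.
Import Order.TTheory GRing.Theory Num.Theory.
Import numFieldNormedType.Exports.
Local Open Scope classical_set_scope.
Local Open Scope ring_scope.
Set Implicit Arguments.
Unset Strict Implicit.
Unset Printing Implicit Defensive.

(** Set g := f1 - f2, a continuous function. The claim is that g vanishes
outside the ball of radius eps, knowing that the weighted integrals of g over
the spindle (lemon) surfaces [|x|^2 + 2 r d(x) = 1], with d(x) the distance to
the axis, vanish for every direction of the axis and every 0 <= r <= delta.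

Reduction to a function of two variables. The integral over a surface depends
only on the axis, so it vanishes after any orthogonal change of coordinates h,
by Euler's decomposition of h ([orthonormal_euler],
[lemon_integral_orthonormal]). Fix a direction and take h that maps the third
axis to it; then average over the rotations about that axis: g is replaced by
its zonal average K(rho, t), where t is the cosine of the colatitude, and the
data become integrals of the means of K(rho, .) over circles of the sphere
([zonal_average_transform]).

Reduction to scalar equations. Circular means over circles of colatitude phi are
self-adjoint on zonal functions ([zonal_mean_adjoint]) and map [t^(2k)] to [c
t^(2k)] plus lower even powers, where c is a polynomial in [sin^2 phi],
proportional to the Legendre polynomial of degree 2k at [cos phi]
([zonal_triangular], [zonal_symbol]). Hence, by induction on k, the even moment
[g_k(rho)] of K(rho, .) satisfies the scalar equation [int_0^pi sin phi *
P(sin^2 phi) * q(r sin phi) dphi = 0], where q is g_k up to a positive factor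
and a change of variable, and [P(1) != 0].

Solving the scalar equation. It is a generalised Abel equation. Putting [r = x
|cos psi|] and integrating over psi gives an integral over the sphere of a
function of two coordinates; computing it in polar coordinates about another
axis gives [int_0^1 L(y) q(x y) dy = 0] with a smooth kernel such that [L(1) !=
0] ([abel_composition]). After an integration by parts this is a Volterra
equation of the second kind for the primitive of q, and q vanishes near 0
because of the support of g, so q = 0 ([abel_injective]).

Conclusion. All even moments of K(rho, .) vanish, hence so does [K(rho, 1) +
K(rho, -1)] ([even_moments_eq0]), that is [g(x) + g(-x) = 0] for the points x of
norm rho on the chosen axis. One of x and -x is outside the upper half space, so
g(x) = 0.

The analytic input common to the adjointness and to the Abel equation is that
the integral over the sphere is the same in polar coordinates about two
different axes ([sphere_int_axis_swap]). Both sides are bounded functionals of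
the integrand, so that it is enough to compare them on monomials, where they are
Wallis integrals. The same principle, based on the Bernstein approximation
[tensor_approximation], also gives Fubini's theorem for continuous functions on
rectangles. *)

(** * Continuity of explicit expressions *)

Section Continuity.
Context {R : realType} {T : topologicalType}.
Implicit Types f g : T -> R.

Lemma cont_cst {U : topologicalType} (c : U) : continuous (fun _ : T => c).
Proof. by move=> t; exact: cst_continuous. Qed.

Lemma cont_add f g : continuous f -> continuous g ->
  continuous (fun t => f t + g t).
Proof. by move=> cf cg t; apply: cvgD; [exact: cf|exact: cg]. Qed.

Lemma cont_opp f : continuous f -> continuous (fun t => - f t).
Proof. by move=> cf t; apply: cvgN; exact: cf. Qed.

Lemma cont_mul f g : continuous f -> continuous g ->
  continuous (fun t => f t * g t).
Proof. by move=> cf cg t; apply: cvgM; [exact: cf|exact: cg]. Qed.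

Lemma cont_exp f n : continuous f -> continuous (fun t => f t ^+ n).
Proof.
move=> cf; elim: n => [|n IHn].
  by under eq_fun do rewrite expr0; exact: cont_cst.
by under eq_fun do rewrite exprS; exact: cont_mul.
Qed.

Lemma cont_norm f : continuous f -> continuous (fun t => `|f t|).
Proof. by move=> cf t; apply: cvg_norm; exact: cf. Qed.

Lemma cont_comp (h : R -> R) f : continuous h -> continuous f ->
  continuous (fun t => h (f t)).
Proof. by move=> ch cf t; apply: continuous_comp; [exact: cf|exact: ch]. Qed.

Lemma cont_pair {U V : topologicalType} (f : T -> U) (g : T -> V) :
  continuous f -> continuous g -> continuous (fun t => (f t, g t)).
Proof. by move=> cf cg t; apply: cvg_pair; [exact: cf|exact: cg]. Qed.

Lemma cont_fst {U V : topologicalType} (f : T -> U * V) :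
  continuous f -> continuous (fun t => (f t).1).
Proof. by move=> cf t; apply: (@continuous_comp _ _ _ f fst); [exact: cf|exact: cvg_fst]. Qed.

Lemma cont_snd {U V : topologicalType} (f : T -> U * V) :
  continuous f -> continuous (fun t => (f t).2).
Proof. by move=> cf t; apply: (@continuous_comp _ _ _ f snd); [exact: cf|exact: cvg_snd]. Qed.

Lemma cont_id : continuous (fun t : T => t).
Proof. by move=> t; exact: cvg_id. Qed.

Lemma cont_sum (I : Type) (r : seq I) (P : pred I) (F : I -> T -> R) :
  (forall i, continuous (F i)) -> continuous (fun t => \sum_(i <- r | P i) F i t).
Proof.
move=> cF; elim: r => [|i r IHr].
  by under eq_fun do rewrite big_nil; exact: cont_cst.
under eq_fun do rewrite big_cons; case: (P i) => //.
exact: cont_add.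
Qed.

Lemma cont_inv f : (forall t, f t != 0) -> continuous f ->
  continuous (fun t => (f t)^-1).
Proof. by move=> f0 cf t; apply: cvgV; [exact: f0|exact: cf]. Qed.

Lemma cont_comp2 {U V : topologicalType} (h : U -> V -> R) (f : T -> U) (g : T -> V) :
  continuous (fun z : U * V => h z.1 z.2) -> continuous f -> continuous g ->
  continuous (fun t => h (f t) (g t)).
Proof.
move=> ch cf cg t.
apply: (@continuous_comp _ _ _ (fun t => (f t, g t)) (fun z => h z.1 z.2)).
  exact: cont_pair.
exact: ch.
Qed.

Lemma cont_comp3 {U V W : topologicalType} (h : U -> V -> W -> R)
    (e : T -> U) (f : T -> V) (g : T -> W) :
  continuous (fun z : U * V * W => h z.1.1 z.1.2 z.2) ->
  continuous e -> continuous f -> continuous g ->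
  continuous (fun t => h (e t) (f t) (g t)).
Proof.
move=> ch ce cf cg t.
apply: (@continuous_comp _ _ _ (fun t => (e t, f t, g t))
  (fun z => h z.1.1 z.1.2 z.2)).
  by apply: cont_pair => //; exact: cont_pair.
exact: ch.
Qed.

End Continuity.

Lemma cont_cos {R : realType} {T : topologicalType} (f : T -> R) :
  continuous f -> continuous (fun t => cos (f t)).
Proof. by apply: cont_comp; exact: continuous_cos. Qed.
Lemma cont_sin {R : realType} {T : topologicalType} (f : T -> R) :
  continuous f -> continuous (fun t => sin (f t)).
Proof. by apply: cont_comp; exact: continuous_sin. Qed.
Lemma cont_sqrt {R : realType} {T : topologicalType} (f : T -> R) :
  continuous f -> continuous (fun t => Num.sqrt (f t)).
Proof. by apply: cont_comp; exact: sqrt_continuous. Qed.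
Lemma cont_horner {R : realType} {T : topologicalType} (p : {poly R}) (f : T -> R) :
  continuous f -> continuous (fun t => p.[f t]).
Proof. by apply: cont_comp; exact: continuous_horner. Qed.

(** Redefined below by the rule for integrals with a parameter. *)
Ltac cont_integral := fail.

(** The head symbol of the function selects the rule, so that unification never has
to unfold real operations. *)
Ltac cont_step :=
  cbv beta;
  match goal with
  | H : ?G |- ?G => exact H
  | |- continuous (fun _ => ?c) => exact: cont_cst
  | |- continuous (fun t => t) => exact: cont_id
  | |- continuous (fun t => @?f t + @?g t) => apply (@cont_add _ _ f g)
  | |- continuous (fun t => - @?f t) => apply (@cont_opp _ _ f)
  | |- continuous (fun t => @?f t * @?g t) => apply (@cont_mul _ _ f g)
  | |- continuous (fun t => @?f t ^+ ?n) => apply (@cont_exp _ _ f n)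
  | |- continuous (fun t => cos (@?f t)) => apply (@cont_cos _ _ f)
  | |- continuous (fun t => sin (@?f t)) => apply (@cont_sin _ _ f)
  | |- continuous (fun t => Num.sqrt (@?f t)) => apply (@cont_sqrt _ _ f)
  | |- continuous (fun t => `|@?f t|) => apply (@cont_norm _ _ f)
  | |- continuous (fun t => ?p.[@?f t]) => apply (@cont_horner _ _ p f)
  | |- continuous (fun t => (@?f t).1) => apply (@cont_fst _ _ _ f)
  | |- continuous (fun t => (@?f t).2) => apply (@cont_snd _ _ _ f)
  | |- continuous (fun t => (@?f t, @?g t)) => apply (@cont_pair _ _ _ f g)
  | H : continuous (fun z => ?F z.1.1 z.1.2 z.2) |-
      continuous (fun t => ?F (@?a t) (@?b t) (@?c t)) =>
        apply (@cont_comp3 _ _ _ _ _ F a b c H)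
  | H : continuous (fun z => ?F z.1 z.2) |-
      continuous (fun t => ?F (@?a t) (@?b t)) =>
        apply (@cont_comp2 _ _ _ _ F a b H)
  | H : continuous (fun z => ?F z.1 z.2) |- continuous (?F ?u) =>
        apply (@cont_comp2 _ _ _ _ F (fun=> u) (fun t => t) H)
  | |- continuous (horner _) => exact: continuous_horner
  | H : continuous ?h |- continuous (fun t => ?h (@?f t)) =>
        apply (@cont_comp _ _ h f H)
  | |- _ => cont_integral
  | |- _ => apply: cont_sum => ?
  end.

Ltac cont := repeat cont_step.

(** * Integrals of continuous functions over segments *)

Section SegmentIntegral.
Context {R : realType}.
Implicit Types (a b c : R) (f g F : R -> R).

Definition segint a b f : R := \int[lebesgue_measure]_(x in `[a, b]) f x.

Lemma segint_integrable a b f : continuous f ->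
  (@lebesgue_measure R).-integrable `[a, b] (EFin \o f).
Proof.
move=> cf; apply: continuous_compact_integrable; first exact: segment_compact.
exact: continuous_subspaceT.
Qed.

Lemma eq_segint a b f g : (forall x, a <= x <= b -> f x = g x) ->
  segint a b f = segint a b g.
Proof.
move=> fg; apply: eq_Rintegral => x; rewrite inE/= in_itv/=; exact: fg.
Qed.

Lemma segintD a b f g : continuous f -> continuous g ->
  segint a b (fun x => f x + g x) = segint a b f + segint a b g.
Proof.
move=> cf cg; apply: RintegralD; first exact: measurable_itv.
- exact: segint_integrable.
- exact: segint_integrable.
Qed.

Lemma segintB a b f g : continuous f -> continuous g ->
  segint a b (fun x => f x - g x) = segint a b f - segint a b g.
Proof.
move=> cf cg; apply: RintegralB; first exact: measurable_itv.
- exact: segint_integrable.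
- exact: segint_integrable.
Qed.

Lemma segintZ a b c f : continuous f ->
  segint a b (fun x => c * f x) = c * segint a b f.
Proof.
by move=> cf; apply: RintegralZl;
  [exact: measurable_itv|exact: segint_integrable].
Qed.

Lemma segintZr a b c f : continuous f ->
  segint a b (fun x => f x * c) = segint a b f * c.
Proof.
by move=> cf; apply: RintegralZr;
  [exact: measurable_itv|exact: segint_integrable].
Qed.

Lemma segint_cst a b c : a <= b -> segint a b (fun=> c) = c * (b - a).
Proof.
move=> ab; rewrite /segint Rintegral_cst; last exact: measurable_itv.
rewrite /= (@lebesgue_measure_itv R `[a, b]%R) /= lte_fin; move: ab; rewrite le_eqVlt => /orP[/eqP ->|ab].
  by rewrite ltxx subrr.
by rewrite ab.
Qed.

Lemma segint_sum a b n (F : 'I_n -> R -> R) : (forall i, continuous (F i)) ->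
  segint a b (fun x => \sum_(i < n) F i x) = \sum_(i < n) segint a b (F i).
Proof.
elim: n F => [|n IHn] F cF.
  rewrite big_ord0; under [X in segint _ _ X]eq_fun do rewrite big_ord0.
  by rewrite /segint Rintegral_cst ?mul0r//; exact: measurable_itv.
rewrite big_ord_recl; under [X in segint _ _ X]eq_fun do rewrite big_ord_recl.
by rewrite segintD ?IHn//; cont.
Qed.

Lemma le_segint a b f g : continuous f -> continuous g ->
  (forall x, a <= x <= b -> f x <= g x) -> segint a b f <= segint a b g.
Proof.
move=> cf cg fg; apply: le_Rintegral; [exact: measurable_itv| | |].
- exact: segint_integrable.
- exact: segint_integrable.
- by move=> x /=; rewrite in_itv/=; exact: fg.
Qed.

Lemma segint_ge0 a b f : (forall x, a <= x <= b -> 0 <= f x) -> 0 <= segint a b f.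
Proof. by move=> f0; apply: Rintegral_ge0 => x /=; rewrite in_itv/=; exact: f0. Qed.

Lemma segint_norm_le a b f g : continuous f -> continuous g ->
  (forall x, a <= x <= b -> `|f x| <= g x) ->
  `|segint a b f| <= segint a b g.
Proof.
move=> cf cg fg; apply: (le_trans (le_normr_Rintegral _ _)).
- exact: measurable_itv.
- exact: segint_integrable.
- by apply: le_segint => //; cont.
Qed.

Lemma segint_norm_le_cst a b f c : a <= b -> continuous f ->
  (forall x, a <= x <= b -> `|f x| <= c) -> `|segint a b f| <= c * (b - a).
Proof.
by move=> ab cf fc; rewrite -segint_cst//; apply: segint_norm_le => //; cont.
Qed.

Lemma segint_point a f : segint a a f = 0.
Proof. by rewrite /segint set_itv1 Rintegral_set1. Qed.

Lemma segint_split a b c f : continuous f -> a <= b -> b <= c ->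
  segint a c f = segint a b f + segint b c f.
Proof.
move=> cf ab bc; apply/eqP; rewrite addrC -subr_eq; apply/eqP.
rewrite /segint Rintegral_itvB ?bnd_simp//; last exact: segint_integrable.
rewrite Rintegral_itv_obnd_cbnd//.
apply: integrableS (segint_integrable a c cf) => //.
by apply: subset_itvr; rewrite bnd_simp.
Qed.

Lemma segint_FTC2 a b f F : a <= b -> continuous f ->
  (forall x : R, is_derive x 1 F (f x)) -> segint a b f = F b - F a.
Proof.
move=> ab cf dF; move: ab; rewrite le_eqVlt => /orP[/eqP ->|ab].
  by rewrite segint_point subrr.
have cF : continuous F.
  by move=> x; apply/differentiable_continuous/derivable1_diffP; case: (dF x).
rewrite /segint /Rintegral (@continuous_FTC2 _ f F)//.
- exact: continuous_subspaceT.
- split.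
  + by move=> x _; case: (dF x).
  + exact: cvg_at_right_filter (cF a).
  + exact: cvg_at_left_filter (cF b).
- by move=> x _; rewrite derive1E; case: (dF x).
Qed.

Lemma segint_FTC1 a f (x : R) : continuous f -> a < x ->
  is_derive x 1 (fun y => segint a y f) (f x).
Proof.
move=> cf ax.
have xx1 : x < x + 1 by rewrite ltrDl.
have [d e] := continuous_FTC1_closed xx1 (segint_integrable a (x + 1) cf) ax (cf x).
rewrite derive1E in e; exact: DeriveDef d e.
Qed.

End SegmentIntegral.

Section ParametricIntegral.
Context {R : realType}.

(** Tube lemma: the segment is compact, so a jointly continuous function is
uniformly continuous in the parameter near each of its values. *)
Lemma near_uniform_segment {T : topologicalType} (F : T -> R -> R) (t0 : T) (a b e : R) :
  continuous (fun z : T * R => F z.1 z.2) -> 0 < e ->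
  \forall t \near t0, forall x, a <= x <= b -> `|F t x - F t0 x| < e.
Proof.
move=> cF e0.
have /compact_near_coveringP ncov := @segment_compact R a b.
have H := ncov T (nbhs t0) (fun t x => `|F t x - F t0 x| < e) (nbhs_filter t0).
have {}H : \forall t \near t0, `[a, b] `<=` (fun x => `|F t x - F t0 x| < e).
  apply: H => x _.
  have c1 : continuous (fun z : R * T => F z.2 z.1 - F t0 z.1) by cont.
  have := c1 (x, t0).
  move=> /cvgrPdist_lt /(_ e e0); rewrite /= subrr.
  by apply: filterS => z/=; rewrite sub0r normrN.
by apply: filterS H => t + x xab; apply; rewrite /= in_itv.
Qed.

Lemma cont_segint {T : topologicalType} (F : T -> R -> R) (a b : R) :
  continuous (fun z : T * R => F z.1 z.2) ->
  continuous (fun t => segint a b (F t)).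
Proof.
move=> cF t0; have [ab|ba] := leP a b; last first.
  rewrite (_ : (fun t => _) = fun=> 0); first exact: cvg_cst.
  apply/funext => t; rewrite /segint set_itv_ge ?Rintegral_set0//.
  by rewrite bnd_simp -ltNge.
apply/cvgrPdist_le => e e0.
have d0 : 0 < e / (b - a + 1) by rewrite divr_gt0// ltr_wpDl// subr_ge0.
have := near_uniform_segment t0 a b cF d0.
apply: filterS => t tab; rewrite -segintB; [|cont|cont].
apply: (@le_trans _ _ (e / (b - a + 1) * (b - a))).
  apply: segint_norm_le_cst => //; first by cont.
  by move=> x xab; rewrite distrC; apply/ltW/tab.
rewrite mulrAC -mulrA ler_piMr ?(ltW e0)// ler_pdivrMr ?ltr_wpDl ?subr_ge0//.
by rewrite mul1r lerDl.
Qed.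

Lemma uniform_modulus (F : R -> R -> R) (a b c d e : R) :
  continuous (fun z : R * R => F z.1 z.2) -> 0 < e ->
  exists2 m, 0 < m & forall x x' y, a <= x <= b -> c <= y <= d ->
    `|x - x'| < m -> `|F x y - F x' y| < e.
Proof.
move=> cF e0.
have /compact_near_coveringP ncov :=
  compact_setX (@segment_compact R a b) (@segment_compact R c d).
have PF : Filter ((0 : R)^'+) by typeclasses eauto.
have H := ncov R (0^'+) (fun m z => forall x', `|z.1 - x'| < m ->
   `|F z.1 z.2 - F x' z.2| < e) PF.
have {}H : \forall m \near (0:R)^'+, (`[a, b] `*` `[c, d]) `<=` 
  (fun z => forall x', `|z.1 - x'| < m -> `|F z.1 z.2 - F x' z.2| < e).
  apply: H => -[x y] _.
  have := cF (x, y); move/cvgrPdist_lt => /(_ (e / 2)); rewrite divr_gt0//.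
  move=> /(_ erefl) /nbhs_ballP [r /= r0 Hr].
  have r20 : 0 < r / 2 by rewrite divr_gt0.
  exists (ball (x, y) (r / 2), [set m : R | m < r / 2]) => /=.
    by split; [exact: nbhsx_ballx|exact: nbhs_right_lt].
  move=> [[x1 y1] m] /= [[xx1 yy1] mr] x' x1x'.
  have h1 : `|F x y - F x1 y1| < e / 2.
    by apply: (Hr (x1, y1)); split; apply: le_ball; [|exact: xx1| |exact: yy1];
      rewrite ler_pdivrMr// ler_peMr ?ltW// ltrDl.
  have h2 : `|F x y - F x' y1| < e / 2.
    apply: (Hr (x', y1)); split => /=.
      rewrite (splitr r); apply: ball_triangle xx1 _.
      exact: lt_trans mr.
    by apply: le_ball yy1; rewrite ler_pdivrMr// ler_peMr ?ltW// ltrDl.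
  rewrite (_ : _ - _ = (F x y - F x' y1) - (F x y - F x1 y1)); last by ring.
  by rewrite (le_lt_trans (ler_normB _ _))// (splitr e) ltrD.
near (0:R)^'+ => m.
exists m; first by near: m; exact: nbhs_right_gt.
move=> x x' y xab ycd xx'; apply: (near H m _ (x, y)) => //.
Unshelve. all: by end_near.
Qed.
End ParametricIntegral.

Ltac cont_integral ::=
  match goal with
  | |- continuous (fun t => segint ?a ?b (@?F t)) => apply (@cont_segint _ _ F a b)
  end.

(** * Bernstein approximation *)

Section Bernstein.
Context {R : realType}.
Implicit Types (x u : R) (h k : nat -> R) (n : nat).

(** The Bernstein operator, as the expectation of [h] at the number of successes
in [n] independent trials of probability [u].  The recursion conditions on one
trial; it replaces sums of binomial coefficients in the proofs. *)
Fixpoint binexp n u h : R :=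
  if n is m.+1 then u * binexp m u (fun i => h i.+1) + (1 - u) * binexp m u h
  else h 0%N.

Lemma binexp_affine n u (c d : R) h :
  binexp n u (fun i => c + d * h i) = c + d * binexp n u h.
Proof. by elim: n h => //= n IHn h; rewrite (IHn (h \o S)) IHn /=; ring. Qed.

Lemma ler_binexp n u h k : 0 <= u <= 1 ->
  (forall i, (i <= n)%N -> h i <= k i) -> binexp n u h <= binexp n u k.
Proof.
move=> /andP[u0 u1]; elim: n h k => /= [|n IHn] h k hk; first exact: hk.
apply: lerD; apply: ler_wpM2l => //; rewrite ?subr_ge0//; apply: IHn => i ni.
  exact: hk.
by apply: hk; rewrite (leq_trans ni).
Qed.

Lemma binexp_norm n u h : 0 <= u <= 1 ->
  `|binexp n u h| <= binexp n u (fun i => `|h i|).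
Proof.
move=> u01; elim: n h => //= n IHn h; move/andP: (u01) => [u0 u1].
rewrite (le_trans (ler_normD _ _))// !normrM (ger0_norm u0) (@ger0_norm _ (1 - u)) ?subr_ge0//.
apply: lerD; apply: ler_wpM2l; rewrite ?subr_ge0 ?u0 ?u1 //; exact: IHn.
Qed.

(** The second moment about [c]: the variance is [n u (1 - u)]. *)
Lemma binexp_variance n u c :
  binexp n u (fun i => (i%:R - c) ^+ 2) = (n%:R * u - c) ^+ 2 + n%:R * u * (1 - u).
Proof.
elim: n c => [|n IHn] c /=; first by ring.
rewrite IHn (_ : (fun i => _) = fun i => (i%:R - (c - 1)) ^+ 2) ?IHn; first by ring.
by apply/funext => i; congr (_ ^+ 2); rewrite -natr1; ring.
Qed.

Lemma binexp_poly n : exists B : nat -> {poly R}, forall u h,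
  binexp n u h = \sum_(i < n.+1) (B i).[u] * h i.
Proof.
elim: n => [|n [B HB]].
  by exists (fun=> 1) => u h /=; rewrite big_ord1 hornerE mul1r.
pose A i := if (i <= n)%N then B i else 0.
pose C i := if i is j.+1 then B j else 0.
exists (fun i => 'X * C i + (1 - 'X) * A i) => u h /=.
rewrite !HB !mulr_sumr.
under [RHS]eq_bigr do rewrite !hornerE mulrDl.
rewrite big_split /=; congr (_ + _).
  rewrite [RHS]big_ord_recl /= !hornerE ?mulr0 ?mul0r ?add0r.
  by apply: eq_bigr => i _; rewrite mulrA.
rewrite [RHS]big_ord_recr /= /A ltnn !hornerE ?mulr0 ?mul0r ?addr0.
by apply: eq_bigr => i _; rewrite -ltnS ltn_ord mulrA.
Qed.

Lemma bounded_rectangle (F : R -> R -> R) (a b c d : R) :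
  continuous (fun z : R * R => F z.1 z.2) ->
  exists2 M, 0 <= M & forall x y, a <= x <= b -> c <= y <= d -> `|F x y| <= M.
Proof.
move=> cF.
have /compact_bounded[M [_ HM]] := continuous_compact
  (continuous_subspaceT cF) (compact_setX (@segment_compact R a b) (@segment_compact R c d)).
exists (`|M| + 1); first by rewrite addr_ge0.
move=> x y xab ycd; apply: (HM (`|M| + 1)); first by rewrite (le_lt_trans (ler_norm M))// ltrDl.
by exists (x, y) => //; split; rewrite /= in_itv.
Qed.

(** Bernstein's proof of Weierstrass' theorem, done in the first variable only and
uniformly in the second one.  The error at the node [s i] is at most [e / 2] for
close nodes, by uniform continuity, and at most [2 M] for the others; the
variance bound shows that the latter have small total weight. *)
Theorem tensor_approximation (F : R -> R -> R) (a b c d e : R) :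
  a < b -> continuous (fun z : R * R => F z.1 z.2) -> 0 < e ->
  exists n (p : nat -> {poly R}) (s : nat -> R), forall x y,
    a <= x <= b -> c <= y <= d ->
    `|F x y - \sum_(i < n) (p i).[x] * F (s i) y| <= e.
Proof.
move=> ab cF e0; have ba0 : 0 < b - a by rewrite subr_gt0.
have [M M0 HM] := bounded_rectangle a b c d cF.
have [m m0 Hm] := uniform_modulus a b c d cF (divr_gt0 e0 (@ltr0n R 2)).
(* [K * (x - s i) ^+ 2] dominates [2 * M] at the nodes at distance at least [m]. *)
pose K := 2 * M / m ^+ 2.
have K0 : 0 <= K by rewrite divr_ge0 ?mulr_ge0 ?exprn_ge0 ?(ltW m0).
pose n := (Num.trunc (K * (b - a) ^+ 2 / (e / 2))).+1.
have n0 : 0 < n%:R :> R by rewrite ltr0n.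
have Kn : K * (b - a) ^+ 2 / n%:R <= e / 2.
  rewrite ler_pdivrMr// -ler_pdivrMl ?divr_gt0// [leLHS]mulrC.
  by apply/ltW; exact: truncnS_gt.
have [B HB] := binexp_poly n.
pose s i := a + (b - a) * (i%:R / n%:R).
exists n.+1, (fun i => B i \Po ((b - a)^-1 *: ('X - a%:P))), s => x y xab ycd.
pose u := (x - a) / (b - a).
have -> : \sum_(i < n.+1) (B i \Po ((b - a)^-1 *: ('X - a%:P))).[x] * F (s i) y =
    binexp n u (fun i => F (s i) y).
  rewrite HB; apply: eq_bigr => i _; rewrite horner_comp !hornerE.
  by congr ((B i).[_] * _); rewrite mulrC.
have u01 : 0 <= u <= 1.
  rewrite /u divr_ge0 ?ler_pdivrMr ?mul1r ?lerD2r ?subr_ge0//; 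
    by case/andP: xab => // *; exact/ltW.
have xu : x = a + (b - a) * u by rewrite /u mulrCA mulfV ?gt_eqF// mulr1 addrC subrK.
have -> : F x y - binexp n u (fun i => F (s i) y) = 
    binexp n u (fun i => F x y - F (s i) y).
  have := binexp_affine n u (F x y) (-1) (fun i => F (s i) y).
  rewrite mulN1r => <-; congr (binexp n u _).
  by apply/funext => i; rewrite mulN1r.
apply: (le_trans (binexp_norm n _ u01)).
apply: (@le_trans _ _ (binexp n u (fun i => e / 2 + (K * ((b - a) / n%:R) ^+ 2) * (i%:R - n%:R * u) ^+ 2))).
  apply: ler_binexp => // i ni.
  have sab : a <= s i <= b.
    rewrite /s lerDl mulr_ge0 ?divr_ge0 ?(ltW ba0)//= -lerBrDl ler_piMr ?(ltW ba0)//.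
    by rewrite ler_pdivrMr// mul1r ler_nat.
  have -> : K * ((b - a) / n%:R) ^+ 2 * (i%:R - n%:R * u) ^+ 2 = K * (x - s i) ^+ 2.
    by rewrite xu /s; field; rewrite gt_eqF.
  have [lt|ge] := ltP `|x - s i| m.
    rewrite (le_trans (ltW (Hm _ _ _ xab ycd lt)))// lerDl mulr_ge0//.
    by rewrite exprn_even_ge0.
  apply: (le_trans (ler_normB _ _)).
  apply: (@le_trans _ _ (M + M)); first by apply: lerD; exact: HM.
  apply: (@le_trans _ _ (K * (x - s i) ^+ 2)); last by rewrite lerDr divr_ge0// ltW.
  rewrite /K mulrAC ler_pdivlMr ?exprn_gt0// (_ : M + M = 2 * M); last by ring.
  apply: ler_wpM2l; first by rewrite mulr_ge0.
  by rewrite -(real_normK (num_real (x - _))) lerXn2r ?nnegrE// ltW.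
rewrite binexp_affine binexp_variance subrr expr0n /= add0r.
rewrite {2}(splitr e) lerD2l.
rewrite (_ : K * _ * (_ * _ * _) = K * (b - a) ^+ 2 / n%:R * (u * (1 - u))); last first.
  by field; rewrite gt_eqF.
apply: le_trans Kn; apply: ler_piMr.
  by rewrite divr_ge0// mulr_ge0// exprn_ge0// ltW.
by case/andP: u01 => u0 u1; rewrite mulr_ile1 ?subr_ge0// lerBlDr lerDl.
Qed.

End Bernstein.

(** * Bounded functionals, and Fubini's theorem *)

Section Tensor.
Context {R : realType}.

(** Tensors are dense by [tensor_approximation], and the functional is bounded for the
uniform norm on a rectangle. *)
Lemma functional_eq0_on_tensors (a b c d C : R) (Lam : (R -> R -> R) -> R) :
  a < b ->
  (forall F G : R -> R -> R, continuous (fun z : R * R => F z.1 z.2) ->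
     continuous (fun z : R * R => G z.1 z.2) ->
     Lam (fun x y => F x y - G x y) = Lam F - Lam G) ->
  (forall (F : R -> R -> R) (e : R), continuous (fun z : R * R => F z.1 z.2) ->
     (forall x y, a <= x <= b -> c <= y <= d -> `|F x y| <= e) ->
     `|Lam F| <= C * e) ->
  (forall (p : {poly R}) (h : R -> R), continuous h ->
     Lam (fun x y => p.[x] * h y) = 0) ->
  forall F : R -> R -> R, continuous (fun z : R * R => F z.1 z.2) -> Lam F = 0.
Proof.
move=> ab LB Lbd L0 F cF.
have cst0 : continuous (fun z : R * R => (fun _ _ : R => 0 : R) z.1 z.2) by cont.
have Lz : Lam (fun _ _ => 0) = 0.
  rewrite -[RHS](subrr (Lam (fun _ _ => 0))) -LB//; congr Lam.
  by apply/funext => x; apply/funext => y; rewrite subrr.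
have Lsum n (p : nat -> {poly R}) (s : nat -> R) :
    Lam (fun x y => \sum_(i < n) (p i).[x] * F (s i) y) = 0.
  elim: n => [|n IHn].
    by rewrite -[RHS]Lz; congr Lam; apply/funext => x; apply/funext => y; rewrite big_ord0.
  transitivity (Lam (fun x y => \sum_(i < n) (p i).[x] * F (s i) y -
      (- p n).[x] * F (s n) y)).
    congr Lam; apply/funext => x; apply/funext => y.
    by rewrite big_ord_recr /= hornerN mulNr opprK.
  rewrite LB; [|by cont|by cont].
  by rewrite IHn L0 ?subrr//; cont.
have bound e : 0 < e -> `|Lam F| <= C * e.
  move=> e0; have [n [p [s H]]] := tensor_approximation c d ab cF e0.
  rewrite -(subr0 (Lam F)) -(Lsum n p s) -LB; [|by cont|by cont].
  by apply: Lbd => //; cont.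
apply/eqP; rewrite -normr_le0; apply/ler_addgt0Pl => e e0; rewrite addr0.
have C1 : 0 < `|C| + 1 by rewrite ltr_wpDl.
apply: (le_trans (bound (e / (`|C| + 1)) (divr_gt0 e0 C1))).
rewrite mulrCA ler_piMr ?(ltW e0)// ler_pdivrMr// mul1r.
by rewrite (le_trans (ler_norm C))// lerDl.
Qed.

(** Fubini's theorem: it is clear on products, and both iterated integrals are
bounded for the uniform norm. *)
Lemma segint_swap (a b c d : R) (F : R -> R -> R) : a <= b -> c <= d ->
  continuous (fun z : R * R => F z.1 z.2) ->
  segint a b (fun x => segint c d (F x)) =
  segint c d (fun y => segint a b (F^~ y)).
Proof.
rewrite le_eqVlt => /orP[/eqP <- cd cF|ab cd cF].
  rewrite segint_point (@eq_segint _ _ _ _ (fun=> 0)).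
    by rewrite segint_cst// mul0r.
  by move=> y _; rewrite segint_point.
apply/eqP; rewrite -subr_eq0; apply/eqP.
pose Lam (F : R -> R -> R) := segint a b (fun x => segint c d (F x)) -
  segint c d (fun y => segint a b (F^~ y)).
apply: (@functional_eq0_on_tensors a b c d ((d - c) * (b - a) + (b - a) * (d - c)) Lam) => //.
- move=> {cF}F G cF cG; rewrite /Lam.
  rewrite (_ : segint a b _ = segint a b (fun x => segint c d (F x)) -
      segint a b (fun x => segint c d (G x))); last first.
    rewrite -segintB; [|by cont|by cont].
    by apply: eq_segint => x _; rewrite segintB //; cont.
  rewrite (_ : segint c d _ = segint c d (fun y => segint a b (F^~ y)) -
      segint c d (fun y => segint a b (G^~ y))); last first.
    rewrite -segintB; [|by cont|by cont].
    by apply: eq_segint => x _; rewrite segintB //; cont.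
  have rearrange (u v w x : R) : u - v - (w - x) = u - w - (v - x) by ring.
  exact: rearrange.
- move=> {cF}F e cF Fe; rewrite /Lam mulrDl (le_trans (ler_normB _ _))//.
  apply: lerD; rewrite mulrC mulrA.
    apply: segint_norm_le_cst; [exact: ltW|by cont|] => x xab.
    by apply: segint_norm_le_cst; [by []|by cont|] => y ycd; exact: Fe.
  apply: segint_norm_le_cst; [by []|by cont|] => y ycd.
  by apply: segint_norm_le_cst; [exact: ltW|by cont|] => x xab; exact: Fe.
- move=> p h ch; rewrite /Lam.
  rewrite (_ : segint a b _ = segint a b (horner p) * segint c d h); last first.
    rewrite -segintZr; last by cont.
    by apply: eq_segint => x _; rewrite segintZ.
  rewrite -(segintZ c d (segint a b (horner p)))//.
  apply/eqP; rewrite subr_eq0; apply/eqP.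
  by apply: eq_segint => y _; rewrite segintZr//; cont.
Qed.

(** The product case is reduced to monomials by applying
[functional_eq0_on_tensors] again, to functions of the second variable. *)
Lemma functional_eq0_on_monomials (C : R) (Lam : (R -> R -> R) -> R) :
  (forall F G : R -> R -> R, continuous (fun z : R * R => F z.1 z.2) ->
     continuous (fun z : R * R => G z.1 z.2) ->
     Lam (fun x y => F x y - G x y) = Lam F - Lam G) ->
  (forall (F : R -> R -> R) (c : R), continuous (fun z : R * R => F z.1 z.2) ->
     Lam (fun x y => c * F x y) = c * Lam F) ->
  (forall (F : R -> R -> R) (e : R), continuous (fun z : R * R => F z.1 z.2) ->
     (forall x y, -1 <= x <= 1 -> -1 <= y <= 1 -> `|F x y| <= e) ->
     `|Lam F| <= C * e) ->
  (forall i j, Lam (fun x y => x ^+ i * y ^+ j) = 0) ->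
  forall F : R -> R -> R, continuous (fun z : R * R => F z.1 z.2) -> Lam F = 0.
Proof.
move=> LB LZ Lbd Lij.
have N11 : (-1 : R) < 1 by lra.
have cst0 : continuous (fun z : R * R => (fun _ _ : R => 0 : R) z.1 z.2) by cont.
have Lz : Lam (fun _ _ => 0) = 0.
  rewrite -[RHS](mul0r (Lam (fun _ _ => 0))) -LZ//; congr Lam.
  by apply/funext => x; apply/funext => y; rewrite mul0r.
have LD (F G : R -> R -> R) : continuous (fun z : R * R => F z.1 z.2) ->
    continuous (fun z : R * R => G z.1 z.2) ->
    Lam (fun x y => F x y + G x y) = Lam F + Lam G.
  move=> cF cG; rewrite (_ : (fun _ _ => _) = fun x y => F x y - -1 * G x y).
    by rewrite LB ?LZ//; [ring|cont].
  by apply/funext => x; apply/funext => y; rewrite mulN1r opprK.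
have Lsum n (G : nat -> R -> R -> R) :
    (forall i, continuous (fun z : R * R => G i z.1 z.2)) ->
    (forall i, Lam (G i) = 0) -> Lam (fun x y => \sum_(i < n) G i x y) = 0.
  move=> cG G0; elim: n => [|n IHn].
    by rewrite -[RHS]Lz; congr Lam; apply/funext => x; apply/funext => y; rewrite big_ord0.
  rewrite (_ : (fun _ _ => _) = fun x y => \sum_(i < n) G i x y + G n x y).
    by rewrite LD ?IHn ?G0 ?addr0//; apply: cont_sum => i.
  by apply/funext => x; apply/funext => y; rewrite big_ord_recr.
have Lpoly (p q : {poly R}) : Lam (fun x y => p.[x] * q.[y]) = 0.
  rewrite (_ : (fun _ _ => _) = fun x y => \sum_(i < size p) \sum_(j < size q)
     p`_i * q`_j * (x ^+ i * y ^+ j)).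
    apply: (Lsum _ (fun i x y => \sum_(j < size q) p`_i * q`_j * (x ^+ i * y ^+ j))) => i.
      by cont.
    apply: (Lsum _ (fun j x y => p`_i * q`_j * (x ^+ i * y ^+ j))) => j; first by cont.
    by rewrite (LZ (fun x y => x ^+ i * y ^+ j)) ?Lij ?mulr0//; cont.
  apply/funext => x; apply/funext => y; rewrite !horner_coef mulr_suml.
  apply: eq_bigr => i _; rewrite mulr_sumr; apply: eq_bigr => j _; ring.
apply: (functional_eq0_on_tensors N11 LB Lbd) => p h ch.
have cp : continuous (fun z : R * R => (fun x _ : R => p.[x]) z.1 z.2) by cont.
have [M M0 HM] := @bounded_rectangle R (fun x _ => p.[x]) (-1) 1 (-1) 1 cp.
pose Lam1 (G : R -> R -> R) := Lam (fun x y => p.[x] * G y 0).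
rewrite -[LHS]/(Lam1 (fun y _ => h y)).
apply: (@functional_eq0_on_tensors (-1) 1 0 0 (C * M) Lam1) => //.
- move=> F G cF cG; rewrite /Lam1 -LB; [|by cont|by cont].
  by congr Lam; apply/funext => x; apply/funext => y; rewrite mulrBr.
- move=> F e cF Fe; rewrite /Lam1 -mulrA; apply: Lbd; first by cont.
  move=> x y x1 y1; rewrite normrM ler_pM//; first exact: (HM _ _ x1 y1).
  by apply: Fe => //; rewrite lexx.
- move=> q k ck; rewrite /Lam1.
  rewrite (_ : (fun _ _ => _) = fun x y => k 0 * (p.[x] * q.[y])).
    by rewrite LZ ?Lpoly ?mulr0//; cont.
  by apply/funext => x; apply/funext => y; ring.
- by cont.
Qed.

End Tensor.

(** * Change of variables *)

Section Substitution.
Context {R : realType}.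
Implicit Types (f g F G : R -> R) (a b c x : R).

Lemma is_deriveM_fun f g x (df dg : R) : is_derive x 1 f df -> is_derive x 1 g dg ->
  is_derive x 1 (fun t => f t * g t) (f x * dg + df * g x).
Proof.
move=> hf hg; have := is_deriveM hf hg.
by rewrite /GRing.scale /= [g x * df]mulrC.
Qed.

Lemma is_deriveX_fun f n x (df : R) : is_derive x 1 f df ->
  is_derive x 1 (fun t => f t ^+ n) (n%:R * f x ^+ n.-1 * df).
Proof.
move=> hf; have := is_deriveX n hf.
rewrite (_ : f ^+ n = fun t => f t ^+ n)//.
by apply/funext => t; rewrite exprfctE.
Qed.

Lemma is_derive_comp_fun f g x (df dg : R) : is_derive x 1 f df ->
  is_derive (f x) 1 g dg -> is_derive x 1 (fun t => g (f t)) (dg * df).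
Proof.
move=> [hf <-] [hg <-]; apply: DeriveDef.
  apply/derivable1_diffP/differentiable_comp; exact/derivable1_diffP.
by rewrite -derive1E (derive1_comp hf hg) !derive1E.
Qed.

(** Change of variable without monotonicity of [F]: both sides come from the
primitive of [G] based at [c], which is differentiable only beyond [c]; this is why
the values of [F] must stay above [c]. *)
Lemma segint_comp a b c c0 f F (G : R -> R) : c0 < a -> a <= b ->
  continuous F -> continuous f -> continuous G ->
  (forall x, c0 < x -> c < F x /\ is_derive x 1 F (f x)) ->
  segint a b (fun x => G (F x) * f x) = segint c (F b) G - segint c (F a) G.
Proof.
move=> c0a ab cF cf cG HF.
have dP x : c0 < x -> is_derive x 1 (fun t => segint c (F t) G) (G (F x) * f x).
  move=> c0x; have [cFx dF] := HF x c0x.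
  exact: (is_derive_comp_fun dF (segint_FTC1 cG cFx)).
have cP x : c0 < x -> {for x, continuous (fun t => segint c (F t) G)}.
  move=> c0x; apply/differentiable_continuous/derivable1_diffP.
  by case: (dP x c0x).
move: ab; rewrite le_eqVlt => /orP[/eqP <-|ab].
  by rewrite segint_point subrr.
have c0b : c0 < b by exact: lt_trans ab.
rewrite /segint /Rintegral (@continuous_FTC2 _ _ (fun t => segint c (F t) G))//.
- by apply: continuous_subspaceT; cont.
- split.
  + by move=> x /[!in_itv]/= /andP[ax _]; case: (dP x (lt_trans c0a ax)).
  + exact: cvg_at_right_filter (cP a c0a).
  + exact: cvg_at_left_filter (cP b c0b).
- move=> x /[!in_itv]/= /andP[ax _].
  by rewrite derive1E; case: (dP x (lt_trans c0a ax)).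
Qed.

Lemma segint_shift a b c f : a <= b -> continuous f ->
  segint a b (fun x => f (x + c)) = segint (a + c) (b + c) f.
Proof.
move=> ab cf.
have := @segint_comp a b (a - 1 + c) (a - 1) (fun=> 1) (fun x => x + c) f.
under [X in segint a b X = _]eq_fun do rewrite mulr1.
move=> ->//.
- rewrite [X in X - _](@segint_split _ _ (a + c))//.
  + by rewrite addrC addKr.
  + by rewrite lerD2r; lra.
  + by rewrite lerD2r.
- lra.
- by cont.
- by cont.
- move=> x ax; split; first by rewrite ltrD2r.
  have := is_deriveD (is_derive_id x (1:R)) (is_derive_cst c x (1:R)).
  by rewrite addr0.
Qed.

Lemma segint_periodic (p c : R) f : 0 <= c <= p -> continuous f ->
  (forall x, f (x + p) = f x) ->
  segint 0 p (fun x => f (x + c)) = segint 0 p f.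
Proof.
move=> /andP[c0 cp] cf fp; have p0 : 0 <= p by exact: le_trans cp.
rewrite segint_shift// add0r (@segint_split _ _ p)//; last by rewrite lerDl.
rewrite [RHS](@segint_split _ _ c)// addrC; congr (_ + _).
rewrite -{1}(add0r p) [p + c]addrC -segint_shift//.
by apply: eq_segint => x _.
Qed.

Lemma segint_cos f : continuous f ->
  segint 0 pi (fun b => sin b * f (cos b)) = segint (-1) 1 f.
Proof.
move=> cf.
have c2 : (-2 : R) <= -1 by lra.
have := @segint_comp 0 pi (-2) (-1) (fun x => - sin x) cos f.
have -> : segint 0 pi (fun x => f (cos x) * - sin x) =
    - segint 0 pi (fun b => sin b * f (cos b)).
  rewrite -mulN1r -segintZ; last by cont.
  by apply: eq_segint => x _; ring.
move=> H; apply/eqP; rewrite -eqr_opp H ?pi_ge0//.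
- by rewrite cospi cos0 (@segint_split _ (-2) (-1) 1)//; lra.
- exact: continuous_cos.
- by cont.
- move=> x _; split; last exact: is_derive_cos.
  by rewrite (lt_le_trans _ (cos_geN1 x))//; lra.
Qed.

Lemma segint_scale (x : R) f : 0 < x -> continuous f ->
  segint 0 1 (fun t => f (x * t)) * x = segint 0 x f.
Proof.
move=> x0 cf.
have := @segint_comp 0 1 (-x) (-1) (fun=> x) (fun t => x * t) f.
rewrite segintZr; last by cont.
move=> ->//.
- rewrite mulr1 mulr0 [X in X - _](@segint_split _ _ 0) ?oppr_le0 ?ltW//.
  by rewrite addrC addKr.
- by cont.
- by cont.
- move=> t t1; split; first by rewrite -mulrN1 ltr_pM2l.
  have := is_deriveM_fun (is_derive_cst x t (1:R)) (is_derive_id t (1:R)).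
  by rewrite mul0r addr0 mulr1.
Qed.

End Substitution.

(** * Integrals over the sphere *)

Section Wallis.
Context {R : realType}.
Implicit Types (m n i j : nat) (b : R).

Definition wallis b m n : R := segint 0 b (fun t => sin t ^+ m * cos t ^+ n).

Let segint_derive_eq0 a b (f F : R -> R) : a <= b -> continuous f -> F a = F b ->
  (forall x : R, is_derive x 1 F (f x)) -> segint a b f = 0.
Proof. by move=> ab cf Fab dF; rewrite (segint_FTC2 ab cf dF) Fab subrr. Qed.

Let is_derive_sinX m (t : R) :
  is_derive t 1 (fun t => sin t ^+ m.+1) (m.+1%:R * sin t ^+ m * cos t).
Proof. by have := is_deriveX_fun m.+1 (is_derive_sin t). Qed.

Let is_derive_cosX n (t : R) :
  is_derive t 1 (fun t => cos t ^+ n.+1) (- (n.+1%:R * cos t ^+ n * sin t)).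
Proof. by have := is_deriveX_fun n.+1 (is_derive_cos t); rewrite mulrN. Qed.

Lemma wallis_cos_step b m n : 0 <= b -> sin b = 0 ->
  (m + n + 2)%:R * wallis b m n.+2 = n.+1%:R * wallis b m n.
Proof.
move=> b0 sb; apply/eqP; rewrite -subr_eq0 /wallis -!segintZ; [|by cont|by cont].
rewrite -segintB; [|by cont|by cont].
apply/eqP; apply: (@segint_derive_eq0 _ _ _ (fun t => sin t ^+ m.+1 * cos t ^+ n.+1)) => //.
- by cont.
- by rewrite sb sin0 !expr0n !mul0r.
- move=> t; apply: is_derive_eq; first exact: (is_deriveM_fun (is_derive_sinX m t) (is_derive_cosX n t)).
  have ss := sin2cos2 t; rewrite !exprS !natrD -!natr1; ring: ss.
Qed.

Lemma wallis_sin_step b m : 0 <= b -> sin b = 0 ->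
  m.+2%:R * wallis b m.+2 0 = m.+1%:R * wallis b m 0.
Proof.
move=> b0 sb; apply/eqP; rewrite eq_sym -subr_eq0 /wallis -!segintZ; [|by cont|by cont].
rewrite -segintB; [|by cont|by cont].
apply/eqP; apply: (@segint_derive_eq0 _ _ _ (fun t => sin t ^+ m.+1 * cos t)) => //.
- by cont.
- by rewrite sb sin0 !expr0n !mul0r.
- move=> t; apply: is_derive_eq; first exact: (is_deriveM_fun (is_derive_sinX m t) (is_derive_cos t)).
  have ss := cos2sin2 t; rewrite !exprS -!natr1; ring: ss.
Qed.

Lemma wallis_m1 b m : 0 <= b -> sin b = 0 -> wallis b m 1 = 0.
Proof.
move=> b0 sb; apply: (mulfI (x := m.+1%:R)); first by rewrite pnatr_eq0.
rewrite mulr0 /wallis -segintZ; last by cont.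
apply: (@segint_derive_eq0 _ _ _ (fun t => sin t ^+ m.+1)) => //.
- by cont.
- by rewrite sb sin0 !expr0n.
- by move=> t; apply: is_derive_eq; [exact: is_derive_sinX|rewrite mulrA expr1].
Qed.

Lemma wallis_2pi_sym n : wallis (2 * pi) 0 n = wallis (2 * pi) n 0.
Proof.
have p0 : (0 : R) <= 2 * pi by rewrite mulr_ge0// pi_ge0.
have s0 : sin (2 * pi : R) = 0 by rewrite mulr_natl sin2pi.
elim/ltn_ind: n => -[//|[_|n IHn]].
  rewrite wallis_m1// /wallis; apply/esym/(@segint_derive_eq0 _ _ _ (fun t => - cos t)) => //.
  - by cont.
  - by rewrite mulr_natl cos2pi cos0.
  - by move=> t; have := is_deriveN (is_derive_cos t); rewrite opprK expr1 expr0 mulr1.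
apply: (mulfI (x := n.+2%:R)); first by rewrite pnatr_eq0.
have := wallis_cos_step 0 n p0 s0; rewrite add0n addn2 => ->.
by rewrite wallis_sin_step// IHn.
Qed.

(** The two sides are the integrals over the sphere of [x ^+ i * z ^+ j] in polar
coordinates about the z-axis and about the y-axis.  They satisfy the same
recurrence in [j]. *)
Lemma wallis_exchange i j :
  wallis pi i.+1 j * wallis (2 * pi) 0 i =
  wallis pi (i + j).+1 0 * wallis (2 * pi) i j.
Proof.
have p0 : (0 : R) <= 2 * pi by rewrite mulr_ge0// pi_ge0.
have s0 : sin (2 * pi : R) = 0 by rewrite mulr_natl sin2pi.
have p1 := pi_ge0 R; have s1 := sinpi R.
elim/ltn_ind: j => -[_|[_|j IHj]]; first by rewrite addn0 wallis_2pi_sym.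
  by rewrite !wallis_m1// mul0r mulr0.
have e1 := wallis_cos_step i.+1 j p1 s1.
have e2 := wallis_sin_step (i + j).+1 p1 s1.
have e3 := wallis_cos_step i j p0 s0.
apply: (mulfI (x := (i + j + 3)%:R)); first by rewrite addn3 pnatr_eq0.
transitivity (j.+1%:R * (wallis pi i.+1 j * wallis (2 * pi) 0 i)).
  by rewrite !mulrA -e1 !addSn addn2 addn3.
have e2' : (i + j + 3)%:R * wallis pi (i + j.+2).+1 0 =
    (i + j).+2%:R * wallis pi (i + j).+1 0 by rewrite addn3 !addnS e2.
have e3' : (i + j).+2%:R * wallis (2 * pi) i j.+2 =
    j.+1%:R * wallis (2 * pi) i j by rewrite -e3 addn2.
by rewrite IHj// [RHS]mulrA e2' [RHS]mulrAC e3'; ring.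
Qed.

End Wallis.

Section AxisSwap.
Context {R : realType}.
Implicit Type F : R -> R -> R.

(** The integral over the unit sphere of a function of the coordinates [x] and [z],
in polar coordinates about the z-axis; about the y-axis in the next definition. *)
Definition sphere_int_about_z F : R :=
  segint 0 pi (fun b => segint 0 (2 * pi)
    (fun t => sin b * F (sin b * cos t) (cos b))).

Definition sphere_int_about_y F : R :=
  segint 0 pi (fun b => segint 0 (2 * pi)
    (fun t => sin b * F (sin b * sin t) (sin b * cos t))).

(** Rotation invariance of the measure of the sphere, in the form of an exchange of
two axes.  Both sides are bounded functionals of [F], so that monomials are
enough; for them it is [wallis_exchange]. *)
Theorem sphere_int_axis_swap F : continuous (fun z : R * R => F z.1 z.2) ->
  sphere_int_about_z F = sphere_int_about_y F.
Proof.
move=> cF; apply/eqP; rewrite -subr_eq0; apply/eqP; move: F cF.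
have p0 : (0 : R) <= 2 * pi by rewrite mulr_ge0// pi_ge0.
apply: (@functional_eq0_on_monomials _ (2 * pi * pi + 2 * pi * pi)
  (fun F => sphere_int_about_z F - sphere_int_about_y F)).
- move=> F G cF cG.
  have -> : sphere_int_about_z (fun x y => F x y - G x y) =
      sphere_int_about_z F - sphere_int_about_z G.
    rewrite /sphere_int_about_z -segintB; [|by cont|by cont].
    apply: eq_segint => b _; rewrite -segintB; [|by cont|by cont].
    by apply: eq_segint => t _; rewrite mulrBr.
  have -> : sphere_int_about_y (fun x y => F x y - G x y) =
      sphere_int_about_y F - sphere_int_about_y G.
    rewrite /sphere_int_about_y -segintB; [|by cont|by cont].
    apply: eq_segint => b _; rewrite -segintB; [|by cont|by cont].
    by apply: eq_segint => t _; rewrite mulrBr.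
  have rearrange (u v w x : R) : u - v - (w - x) = u - w - (v - x) by ring.
  exact: rearrange.
- move=> F c cF; rewrite mulrBr; congr (_ - _).
    rewrite /sphere_int_about_z -segintZ; last by cont.
    apply: eq_segint => b _; rewrite -segintZ; last by cont.
    by apply: eq_segint => t _; rewrite mulrCA.
  rewrite /sphere_int_about_y -segintZ; last by cont.
  apply: eq_segint => b _; rewrite -segintZ; last by cont.
  by apply: eq_segint => t _; rewrite mulrCA.
- move=> F e cF Fe.
  have sc (u v : R) : -1 <= u <= 1 -> -1 <= v <= 1 -> -1 <= u * v <= 1.
    rewrite -!ler_norml normrM => u1 v1; exact: mulr_ile1.
  have s1 (t : R) : -1 <= sin t <= 1 by rewrite sin_geN1 sin_le1.
  have c1 (t : R) : -1 <= cos t <= 1 by rewrite cos_geN1 cos_le1.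
  have bd (u v w : R) : -1 <= v <= 1 -> -1 <= w <= 1 -> `|sin u * F v w| <= e.
    move=> v1 w1; rewrite normrM (le_trans _ (Fe v w v1 w1))// ler_piMl//.
    by rewrite ler_norml.
  rewrite mulrDl (le_trans (ler_normB _ _))//.
  have pie : 2 * pi * pi * e = e * (2 * pi - 0) * (pi - 0) by rewrite !subr0; ring.
  rewrite pie; apply: lerD; apply: segint_norm_le_cst; rewrite ?pi_ge0//.
  + by cont.
  + move=> b _; apply: segint_norm_le_cst => //; first by cont.
    by move=> t _; apply: bd => //; exact: sc.
  + by cont.
  + move=> b _; apply: segint_norm_le_cst => //; first by cont.
    by move=> t _; apply: bd => //; exact: sc.
move=> i j; have := wallis_exchange i j; rewrite /wallis => W.
rewrite [X in X - _](_ : _ = segint 0 pi (fun t => sin t ^+ i.+1 * cos t ^+ j) *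
    segint 0 (2 * pi) (fun t => sin t ^+ 0 * cos t ^+ i)); last first.
  rewrite -segintZr; last by cont.
  apply: eq_segint => b _; rewrite -segintZ; last by cont.
  by apply: eq_segint => t _; rewrite exprMn exprS expr0; ring.
rewrite W (_ : sphere_int_about_y _ = segint 0 pi (fun t => sin t ^+ (i + j).+1 * cos t ^+ 0) *
    segint 0 (2 * pi) (fun t => sin t ^+ i * cos t ^+ j)) ?subrr//.
rewrite -segintZr; last by cont.
apply: eq_segint => b _; rewrite -segintZ; last by cont.
by apply: eq_segint => t _; rewrite !exprMn exprS exprD expr0; ring.
Qed.

End AxisSwap.

(** * Volterra inequalities *)

Section Volterra.
Context {R : realType}.
Implicit Types (q Q f : R -> R) (p : {poly R}).

Lemma segint_even f : continuous f -> (forall x, f (- x) = f x) ->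
  segint (-1) 1 f = 2 * segint 0 1 f.
Proof.
move=> cf fe; rewrite (@segint_split _ _ 0)//.
rewrite mulr_natl mulr2n; congr (_ + _).
rewrite /segint /Rintegral; congr fine.
have := @integration_by_substitution_oppr R f 0 1 ler01.
rewrite oppr0 => ->; last exact: continuous_subspaceT.
by apply: eq_integral => x _ /=; rewrite fe.
Qed.

(** At a maximum point of [`|Q|] on [[x1, x2]] the inequality bounds the maximum by
a fraction of itself. *)
Lemma contraction_step_eq0 Q (x1 x2 K : R) : continuous Q -> 0 <= K ->
  x1 <= x2 -> K * (x2 - x1) < 1 -> (forall x, x <= x1 -> Q x = 0) ->
  (forall x M, x1 <= x <= x2 -> (forall y, x1 <= y <= x -> `|Q y| <= M) ->
     `|Q x| <= K * (x - x1) * M) ->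
  forall x, x <= x2 -> Q x = 0.
Proof.
move=> cQ K0 x12 K1 Qz HQ.
have cQn : {within `[x1, x2], continuous (fun x => `|Q x|)}.
  by apply: continuous_subspaceT; cont.
have [z /[!in_itv]/= zx zmax] := EVT_max x12 cQn.
have Qz0 : `|Q z| = 0.
  apply/eqP; rewrite eq_le normr_ge0 andbT.
  have [z1 z2] := andP zx.
  have H : `|Q z| <= K * (z - x1) * `|Q z|.
    apply: HQ => // y /andP[y1 yz]; apply: zmax; rewrite in_itv/= y1/=.
    exact: le_trans yz z2.
  have : K * (z - x1) <= K * (x2 - x1) by rewrite ler_wpM2l// lerD2r.
  move=> /le_lt_trans/(_ K1); move: H; have := normr_ge0 (Q z).
  by nra.
move=> x xx2; have [/Qz//|xx1] := leP x x1.
apply/eqP; rewrite -normr_le0 -Qz0; apply: zmax.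
by rewrite in_itv/= xx2 ltW.
Qed.

(** The step length in [contraction_step_eq0] depends only on [K], so finitely many
steps reach [d]. *)
Lemma volterra_inequality_eq0 Q (u0 d K : R) : continuous Q -> 0 <= K ->
  (forall x, x <= u0 -> Q x = 0) ->
  (forall x x1 M, u0 <= x1 -> x1 <= x -> x <= d ->
     (forall y, y <= x1 -> Q y = 0) ->
     (forall y, x1 <= y <= x -> `|Q y| <= M) -> `|Q x| <= K * (x - x1) * M) ->
  forall x, x <= d -> Q x = 0.
Proof.
move=> cQ K0 Qu0 HQ.
(* A step length with [K * eta < 1]. *)
pose eta := (2 * (K + 1))^-1.
have eta0 : 0 < eta by rewrite invr_gt0 mulr_gt0// ltr_wpDl.
have Keta : K * eta < 1.
  by rewrite /eta ltr_pdivrMr ?mulr_gt0 ?ltr_wpDl//; lra.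
have steps n x : x <= u0 + n%:R * eta -> x <= d -> Q x = 0.
  elim: n x => [|n IHn] x; first by rewrite mul0r addr0 => /Qu0.
  move=> xn xd; have [xl|lx] := leP x (u0 + n%:R * eta); first exact: IHn.
  apply: (@contraction_step_eq0 Q (u0 + n%:R * eta) x K) => //; first exact: ltW.
  - apply: le_lt_trans Keta; apply: ler_wpM2l => //.
    by move: xn; rewrite -natr1 mulrDl mul1r; lra.
  - by move=> y yl; apply: IHn => //; apply: le_trans xd; apply: le_trans (ltW lx).
  - move=> y M /andP[y1 y2]; apply: HQ => //.
    + by rewrite lerDl mulr_ge0// ltW.
    + exact: le_trans xd.
    + move=> w wl; apply: IHn => //.
      by apply: le_trans xd; apply: le_trans (ltW lx).
move=> x xd; apply: (steps (Num.trunc ((x - u0) / eta)).+1) => //.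
by rewrite -lerBlDl -ler_pdivrMr//; apply/ltW/truncnS_gt.
Qed.

Section Primitive.
Variables (q : R -> R) (u0 : R).
Hypotheses (cq : continuous q) (q0 : forall u, u <= u0 -> q u = 0).

Let Q (x : R) := segint u0 x q.

Lemma primitive_below x : x <= u0 -> Q x = 0.
Proof.
rewrite le_eqVlt => /orP[/eqP ->|xu]; first exact: segint_point.
by rewrite /Q /segint set_itv_ge ?Rintegral_set0// bnd_simp -ltNge.
Qed.

Lemma segint_base c x : c <= u0 -> c <= x -> segint c x q = Q x.
Proof.
move=> cu cx.
have z y : y <= u0 -> segint c y q = 0.
  move=> yu; rewrite (@eq_segint _ _ _ _ (fun=> 0)).
    by rewrite /segint Rintegral_cst ?mul0r//; exact: measurable_itv.
  by move=> t /andP[_ ty]; apply: q0; exact: le_trans yu.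
have [xu|ux] := leP x u0; first by rewrite primitive_below// z.
by rewrite (@segint_split _ _ u0)// ?z ?add0r// ltW.
Qed.

(** Differentiability holds at every point, also to the left of [u0], because the
base point can be moved to the left without changing the primitive. *)
Lemma is_derive_primitive (x : R) : is_derive x 1 Q (q x).
Proof.
pose c := Num.min u0 (x - 1).
have cu : c <= u0 by rewrite ge_min lexx.
have cx : c < x by rewrite gt_min ltrBlDr ltrDl ltr01 orbT.
have -> : Q = fun y => segint c y q.
  apply/funext => y; have [yc|cy] := leP c y; first by rewrite segint_base.
  rewrite primitive_below; last by apply/ltW/(lt_le_trans cy).
  by rewrite /segint set_itv_ge ?Rintegral_set0// bnd_simp -ltNge.
exact: segint_FTC1.
Qed.

Lemma continuous_primitive : continuous Q.
Proof.
move=> x; apply/differentiable_continuous/derivable1_diffP.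
by case: (is_derive_primitive x).
Qed.

End Primitive.
End Volterra.

(** * A generalised Abel equation *)

Section AbelInjectivity.
Context {R : realType}.
Implicit Types (q : R -> R) (p : {poly R}).

Lemma twopi_ge0 : (0 : R) <= 2 * pi.
Proof. by rewrite mulr_ge0// pi_ge0. Qed.

(** Abel's trick: the substitution [r := x * `|cos t|], integrated over [t], turns the
equation into an integral over the sphere of
[p.[u ^+ 2 + v ^+ 2] * q (x * `|v|)] in polar coordinates about the y-axis, where the
argument of [p] is the squared sine of the colatitude.  About the z-axis the
argument of [q] is constant in the longitude, and the singular Abel kernel
becomes smooth. *)
Lemma abel_composition p q x : continuous q -> 0 <= x ->
  (forall r, 0 <= r <= x ->
     segint 0 pi (fun b => sin b * (p.[sin b ^+ 2] * q (r * sin b))) = 0) ->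
  segint 0 (2 * pi) (fun t =>
    segint 0 1 (fun y => p.[(1 - y ^+ 2) * cos t ^+ 2 + y ^+ 2] * q (x * y))) = 0.
Proof.
move=> cq x0 Hq.
pose F (u v : R) := p.[u ^+ 2 + v ^+ 2] * q (x * `|v|).
have cF : continuous (fun z : R * R => F z.1 z.2) by rewrite /F; cont.
have Fy : sphere_int_about_y F = 0.
  rewrite /sphere_int_about_y segint_swap; [|exact: pi_ge0|exact: twopi_ge0|by cont].
  rewrite (@eq_segint _ _ _ _ (fun=> 0)); first by rewrite segint_cst ?mul0r ?twopi_ge0.
  move=> t _; rewrite -[RHS](Hq (x * `|cos t|)); last first.
    by rewrite mulr_ge0//= ler_piMr// cos_max.
  apply: eq_segint => b bpi; have sb := sin_ge0_pi bpi.
  rewrite /F normrM (ger0_norm sb) (_ : (sin b * sin t) ^+ 2 + (sin b * cos t) ^+ 2 = sin b ^+ 2).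
    by congr (_ * (_ * q _)); ring.
  have st := cos2sin2 t; ring: st.
have := sphere_int_axis_swap cF; rewrite Fy /sphere_int_about_z.
rewrite segint_swap; [|exact: pi_ge0|exact: twopi_ge0|by cont].
have two0 : (2 : R) != 0 by rewrite pnatr_eq0.
move=> H; apply: (mulfI two0); rewrite mulr0 -[RHS]H -segintZ; last by cont.
apply: eq_segint => t _.
pose f y := p.[(1 - y ^+ 2) * cos t ^+ 2 + y ^+ 2] * q (x * `|y|).
have cf : continuous f by rewrite /f; cont.
transitivity (segint (-1) 1 f).
  rewrite segint_even//; last by move=> y; rewrite /f !sqrrN normrN.
  congr (_ * _); apply: eq_segint => y /andP[y0 _].
  by rewrite /f ger0_norm.
rewrite -segint_cos//; apply: eq_segint => b _; rewrite /f /F.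
by rewrite exprMn sin2cos2.
Qed.

Definition kernel p (y t : R) : R := p.[(1 - y ^+ 2) * cos t ^+ 2 + y ^+ 2].
Definition dkernel p (y t : R) : R :=
  p^`().[(1 - y ^+ 2) * cos t ^+ 2 + y ^+ 2] * (2 * y * (1 - cos t ^+ 2)).

Lemma is_derive_kernel p t (y : R) :
  is_derive y 1 (kernel p ^~ t) (dkernel p y t).
Proof.
have d : is_derive y 1 (fun y : R => (1 - y ^+ 2) * cos t ^+ 2 + y ^+ 2)
    (2 * y * (1 - cos t ^+ 2)).
  have -> : (fun y : R => (1 - y ^+ 2) * cos t ^+ 2 + y ^+ 2) =
     horner ((1 - 'X ^+ 2) * (cos t ^+ 2)%:P + 'X ^+ 2).
    by apply/funext => z; rewrite !hornerE.
  have := is_derive_poly ((1 - 'X ^+ 2) * (cos t ^+ 2)%:P + 'X ^+ 2) y.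
  rewrite !poly.derivE !hornerE; congr is_derive; rewrite /=; ring.
exact: (is_derive_comp_fun d (is_derive_poly p _)).
Qed.

(** Integration by parts against the primitive of [q]: since
[kernel p 1 t = p.[1]] does not depend on [t], the equation becomes of the
second kind. *)
Lemma kernel_by_parts p q u0 x t : continuous q -> (forall u, u <= u0 -> q u = 0) ->
  0 < u0 -> 0 < x ->
  segint 0 1 (fun y => kernel p y t * q (x * y)) * x =
  p.[1] * segint u0 x q - segint 0 x (fun u => dkernel p (u / x) t / x * segint u0 u q).
Proof.
move=> cq q0 u00 x0; set Q := fun x => segint u0 x q.
have dQ := is_derive_primitive cq q0.
have cQ : continuous Q := continuous_primitive cq q0.
have ck : continuous (fun z : R * R => kernel p z.1 z.2) by rewrite /kernel; cont.
have cdk : continuous (fun z : R * R => dkernel p z.1 z.2) by rewrite /dkernel; cont.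
rewrite [LHS](_ : _ = segint 0 1 (fun y => (fun u => kernel p (u / x) t * q u) (x * y)) * x); last first.
  congr (_ * _); apply: eq_segint => y _.
  by rewrite [x * y]mulrC mulfK// gt_eqF.
rewrite (segint_scale (f := fun u => kernel p (u / x) t * q u))//; last by cont.
apply/eqP; rewrite eq_sym subr_eq eq_sym -segintD; [|by cont|by cont].
have x1 : x / x = 1 by rewrite mulfV// gt_eqF.
have dk (u : R) : is_derive u 1 (fun u => kernel p (u / x) t) (dkernel p (u / x) t / x).
  have d : is_derive u 1 (fun u => u / x) x^-1.
    have := is_deriveM_fun (is_derive_id u (1:R)) (is_derive_cst x^-1 u (1:R)).
    by rewrite mulr0 add0r mul1r.
  exact: (is_derive_comp_fun d (is_derive_kernel p t (u / x))).
have dKQ (u : R) : is_derive u 1 (fun u => kernel p (u / x) t * Q u)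
    (kernel p (u / x) t * q u + dkernel p (u / x) t / x * Q u).
  exact: (is_deriveM_fun (dk u) (dQ u)).
rewrite (segint_FTC2 (ltW x0) _ dKQ); last by cont.
rewrite x1 /kernel expr1n subrr mul0r add0r [Q 0]primitive_below ?mulr0 ?subr0//.
exact: ltW.
Qed.

Lemma dkernel_bounded p : exists2 C, 0 <= C &
  forall y t, 0 <= y <= 1 -> 0 <= t <= 2 * pi -> `|dkernel p y t| <= C.
Proof. by apply: bounded_rectangle; rewrite /dkernel; cont. Qed.

(** With [p := 1] this is Abel's integral equation.  The vanishing of [q] near [0]
keeps the Volterra equation away from its singular point. *)
Theorem abel_injective p q (u0 d : R) : p.[1] != 0 -> continuous q ->
  0 < u0 -> (forall u, u <= u0 -> q u = 0) ->
  (forall r, 0 <= r <= d ->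
     segint 0 pi (fun b => sin b * (p.[sin b ^+ 2] * q (r * sin b))) = 0) ->
  forall u, u < d -> q u = 0.
Proof.
move=> p1 cq u00 q0 Hq.
pose Q x := segint u0 x q.
have dQ := is_derive_primitive cq q0.
have cQ : continuous Q := continuous_primitive cq q0.
have Qz x : x <= u0 -> Q x = 0 by exact: primitive_below.
have [C C0 HC] := dkernel_bounded p.
have pi2 : 0 < 2 * pi :> R by rewrite mulr_gt0// pi_gt0.
have ck : continuous (fun z : R * R => kernel p z.1 z.2) by rewrite /kernel; cont.
have cdk : continuous (fun z : R * R => dkernel p z.1 z.2) by rewrite /dkernel; cont.
have identity x : 0 < x -> x <= d ->
    p.[1] * Q x * (2 * pi) =
    segint 0 (2 * pi) (fun t => segint 0 x (fun u => dkernel p (u / x) t / x * Q u)).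
  move=> x0 xd.
  have Hqx r : 0 <= r <= x ->
      segint 0 pi (fun b => sin b * (p.[sin b ^+ 2] * q (r * sin b))) = 0.
    by move=> /andP[r0 rx]; apply: Hq; rewrite r0 (le_trans rx).
  have : segint 0 (2 * pi) (fun t =>
      segint 0 1 (fun y => kernel p y t * q (x * y)) * x) = 0.
    by rewrite segintZr ?(abel_composition cq (ltW x0) Hqx) ?mul0r//; cont.
  rewrite (@eq_segint _ _ _ _ (fun t => p.[1] * Q x -
      segint 0 x (fun u => dkernel p (u / x) t / x * Q u))); last first.
    by move=> t _; exact: kernel_by_parts.
  rewrite segintB; [|by cont|by cont].
  by rewrite segint_cst ?(ltW pi2)// subr0 => /eqP; rewrite subr_eq0 => /eqP.
have Q0 : forall x, x <= d -> Q x = 0.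
  (* For [x >= u0] the Volterra kernel is at most [C / u0]. *)
  pose K := C / u0 / `|p.[1]|.
  apply: (@volterra_inequality_eq0 _ Q u0 d K) => //.
    by rewrite !divr_ge0// ltW.
  move=> x x1 M ux1 x1x xd Qx1 QM.
  have u0x := le_trans ux1 x1x.
  have x0 : 0 < x := lt_le_trans u00 u0x.
  have M0 : 0 <= M by apply: le_trans (normr_ge0 _) (QM x _); rewrite x1x lexx.
  have p10 : 0 < `|p.[1]| by rewrite normr_gt0.
  have bound t : 0 <= t <= 2 * pi ->
      `|segint 0 x (fun u => dkernel p (u / x) t / x * Q u)| <= C / u0 * M * (x - x1).
    move=> t2.
    rewrite (@segint_split _ _ x1)//; [|by cont|].
      rewrite (@eq_segint _ 0 x1 _ (fun=> 0)); last first.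
        by move=> u /andP[_ ux]; rewrite Qx1 ?mulr0.
      rewrite segint_cst ?mul0r ?add0r; last by rewrite (le_trans _ ux1)// ltW.
      apply: segint_norm_le_cst => //; first by cont.
      move=> u /andP[u1 u2]; rewrite normrM; apply: ler_pM => //.
        rewrite normrM; apply: ler_pM => //.
          apply: HC => //; rewrite divr_ge0 ?ler_pdivrMr ?mul1r ?u2 ?(ltW x0)//.
          by rewrite (le_trans _ u1)// (le_trans _ ux1)// ltW.
        by rewrite normfV gtr0_norm// lef_pV2// posrE.
      by apply: QM; rewrite u1.
    by rewrite (le_trans _ ux1)// ltW.
  rewrite -(ler_pM2l p10) -normrM -(ler_pM2r pi2).
  rewrite -{1}(gtr0_norm pi2) -normrM identity//.
  apply: (@le_trans _ _ (C / u0 * M * (x - x1) * (2 * pi - 0))).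
    by apply: segint_norm_le_cst; [exact: ltW|by cont|].
  rewrite subr0 /K le_eqVlt; apply/orP; left; apply/eqP; field.
  by rewrite !gt_eqF.
move=> u ud; have [_ <-] := dQ u.
have Qnear : \near u, Q u = cst 0 u.
  by near=> v; apply: Q0; apply: ltW; near: v; exact: lt_nbhsl.
by rewrite (near_eq_derive (1 : R) Qnear) derive_cst.
Unshelve. all: by end_near.
Qed.

End AbelInjectivity.

(** * Even moments *)

Section EvenMoments.
Context {R : realType}.
Implicit Types (f h H : R -> R).

Lemma segint_reflect f : continuous f ->
  segint (-1) 1 (fun x => f (- x)) = segint (-1) 1 f.
Proof.
move=> cf; rewrite /segint /Rintegral; congr fine.
have N11 : (-1 : R) <= 1 by lra.
have := @integration_by_substitution_oppr R f (-1) 1 N11.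
by rewrite opprK => ->//; exact: continuous_subspaceT.
Qed.

(** Positivity gives the value at the right end point, by integrating over a short
segment that ends there. *)
Lemma segint_eq0_right f (a b : R) : a < b -> continuous f ->
  (forall x, a <= x <= b -> 0 <= f x) -> segint a b f = 0 -> f b = 0.
Proof.
move=> ab cf f0 I0; apply/eqP; rewrite eq_le f0 ?lexx ?(ltW ab)// andbT leNgt.
apply/negP => fb; have fb2 : 0 < f b / 2 by rewrite divr_gt0.
have := cf b; move/cvgrPdist_lt => /(_ _ fb2) /nbhs_ballP[e /= e0 He].
pose d := Num.min (e / 2) (b - a).
have d0 : 0 < d by rewrite lt_min divr_gt0//= subr_gt0.
have de : d < e by rewrite gt_min; apply/orP; left; lra.
have dba : d <= b - a by rewrite ge_min lexx orbT.
move: I0; rewrite (@segint_split _ _ (b - d))//; [|lra|lra].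
apply/eqP; rewrite gt_eqF// ltr_wpDl//.
  by apply: segint_ge0 => x /andP[xa xb]; apply: f0; rewrite xa/= (le_trans xb)//; lra.
apply: (@lt_le_trans _ _ (segint (b - d) b (fun=> f b / 2))).
  by rewrite segint_cst ?mulr_gt0//; lra.
apply: le_segint; [by cont|by []|] => x /andP[x1 x2].
have : `|f b - f x| < f b / 2.
  by apply: He; rewrite /ball/= ger0_norm; lra.
by rewrite ltr_norml => /andP[_]; lra.
Qed.

(** The even part of [H] is orthogonal to all monomials: to the even ones by
hypothesis and to the odd ones by parity.  So it is orthogonal to itself. *)
Lemma even_moments_eq0 H : continuous H ->
  (forall k, segint (-1) 1 (fun t => (t ^+ 2) ^+ k * H t) = 0) ->
  H 1 + H (-1) = 0.
Proof.
move=> cH mH; pose h t := H t + H (- t).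
have ch : continuous h by rewrite /h; cont.
have N11 : (-1 : R) <= 1 by lra.
have hi i : segint (-1) 1 (fun t => h t * t ^+ i) = 0.
  rewrite -(odd_double_half i); case: (odd i); last first.
    rewrite add0n -mul2n; under [X in segint _ _ X]eq_fun do rewrite exprM.
    pose g t := (t ^+ 2) ^+ i./2 * H t.
    have cg : continuous g by rewrite /g; cont.
    have -> : (fun t => h t * (t ^+ 2) ^+ i./2) = fun t => g t + g (- t).
      by apply/funext => t; rewrite /h /g sqrrN; ring.
    by rewrite segintD ?(segint_reflect cg) ?mH ?addr0//; cont.
  have ct : continuous (fun t => h t * t ^+ (1 + i./2.*2)) by cont.
  have := segint_reflect ct.
  have -> : (fun t => h (- t) * (- t) ^+ (1 + i./2.*2)) =
      fun t => -1 * (h t * t ^+ (1 + i./2.*2)).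
    apply/funext => t; rewrite /h opprK !exprD -!mul2n !exprM sqrrN; ring.
  by rewrite segintZ//; lra.
pose Lam (F : R -> R -> R) := segint (-1) 1 (fun t => h t * F t 0).
have L0 : forall F : R -> R -> R, continuous (fun z : R * R => F z.1 z.2) -> Lam F = 0.
  have cxh : continuous (fun z : R * R => (fun x _ : R => h x) z.1 z.2) by cont.
  have [M M0 HM] := @bounded_rectangle R (fun x _ => h x) (-1) 1 (-1) 1 cxh.
  apply: (@functional_eq0_on_monomials R (M * 2)).
  - move=> F G cF cG; rewrite /Lam -segintB; [|by cont|by cont].
    by apply: eq_segint => t _; rewrite mulrBr.
  - move=> F c cF; rewrite /Lam -segintZ; last by cont.
    by apply: eq_segint => t _; rewrite mulrCA.
  - move=> F e cF Fe; rewrite /Lam (_ : M * 2 * e = M * e * (1 - -1)); last by ring.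
    apply: segint_norm_le_cst => //; first by cont.
    move=> x x1; rewrite normrM ler_pM//; first by apply: (HM x 0) => //; lra.
    by apply: Fe => //; lra.
  - move=> i [|j]; rewrite /Lam.
      by rewrite -[RHS](hi i); apply: eq_segint => t _; rewrite expr0 mulr1.
    rewrite (@eq_segint _ _ _ _ (fun=> 0)) ?segint_cst ?mul0r//.
    by move=> t _; rewrite expr0n !mulr0.
have /eqP : h 1 * h 1 = 0.
  apply: (@segint_eq0_right (fun t => h t * h t) (-1) 1); first by lra.
  - by cont.
  - by move=> x _; rewrite -expr2 sqr_ge0.
  - by apply: (L0 (fun x _ => h x)); cont.
by rewrite mulf_eq0 orbb => /eqP.
Qed.

End EvenMoments.

(** * Circular means of zonal functions *)

Section Zonal.
Context {R : realType}.
Implicit Types (H psi : R -> R) (phi : R).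

(** [H] is averaged over the circle of colatitude [phi] around a point of colatitude
[b].  Both sides are integrals over the sphere of a product
[psi (omega . e) * H (omega . e')], where [e] and [e'] make the angle [phi] in the
plane of the first and the third axes.  About the second axis, exchanging the
roles of [e] and [e'] is a shift of the longitude. *)
Lemma zonal_mean_adjoint psi H phi : continuous psi -> continuous H ->
  0 <= phi <= pi ->
  segint 0 pi (fun b => sin b * (psi (cos b) * segint 0 (2 * pi) (fun t =>
    H (cos b * cos phi - sin b * sin phi * cos t)))) =
  segint 0 pi (fun b => sin b * (H (cos b) * segint 0 (2 * pi) (fun t =>
    psi (cos b * cos phi + sin b * sin phi * cos t)))).
Proof.
move=> cpsi cH /andP[phi0 phipi].
pose F1 x z := psi z * H (z * cos phi - x * sin phi).
pose F2 x z := H z * psi (z * cos phi + x * sin phi).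
have cF1 : continuous (fun z : R * R => F1 z.1 z.2) by rewrite /F1; cont.
have cF2 : continuous (fun z : R * R => F2 z.1 z.2) by rewrite /F2; cont.
transitivity (sphere_int_about_z F1).
  apply: eq_segint => b _; rewrite mulrA -segintZ; last by cont.
  by apply: eq_segint => t _; rewrite /F1 mulrA [sin b * sin phi * _]mulrAC.
transitivity (sphere_int_about_z F2); last first.
  apply: eq_segint => b _; rewrite mulrA -segintZ; last by cont.
  by apply: eq_segint => t _; rewrite /F2 mulrA [sin b * sin phi * _]mulrAC.
rewrite (sphere_int_axis_swap cF1) (sphere_int_axis_swap cF2).
apply: eq_segint => b _.
pose f t := sin b * F2 (sin b * sin t) (sin b * cos t).
(* About the second axis, the two integrands differ by the shift [phi] of the
   longitude. *)
rewrite -[RHS](@segint_periodic _ (2 * pi) phi f).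
- apply: eq_segint => t _; rewrite /f /F1 /F2 sinD cosD.
  rewrite [psi _ * _]mulrC; congr (_ * (H _ * psi _)); first by ring.
  by have e := sin2cos2 phi; ring: e.
- by rewrite phi0 (le_trans phipi)// mulr_natl mulr2n lerDl pi_ge0.
- by rewrite /f; cont.
- by move=> t; rewrite /f mulr_natl sinD2pi cosD2pi.
Qed.

Lemma sum_even_terms (V : zmodType) (f : nat -> V) k :
  (forall j, f j.*2.+1 = 0) ->
  \sum_(i < k.*2.+1) f i = \sum_(j < k.+1) f j.*2.
Proof.
move=> f0; elim: k => [|k IHk]; first by rewrite !big_ord1.
by rewrite doubleS 2!big_ord_recr /= IHk f0 addr0 [RHS]big_ord_recr.
Qed.

Definition cos_moment j : R := wallis (2 * pi) 0 j.*2.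

Lemma odd_cos_moment j : wallis (2 * pi : R) 0 j.*2.+1 = 0.
Proof.
have s0 : sin (2 * pi : R) = 0 by rewrite mulr_natl sin2pi.
elim: j => [|j IHj]; first by rewrite wallis_m1// twopi_ge0.
apply: (mulfI (x := (0 + j.*2.+1 + 2)%:R)); first by rewrite addn2 pnatr_eq0.
by rewrite doubleS wallis_cos_step// ?IHj ?mulr0// twopi_ge0.
Qed.

Lemma cos_moment_gt0 j : 0 < cos_moment j.
Proof.
have s0 : sin (2 * pi : R) = 0 by rewrite mulr_natl sin2pi.
rewrite /cos_moment; elim: j => [|j IHj].
  rewrite /wallis (@eq_segint _ _ _ _ (fun=> 1)); last by move=> t _; rewrite !expr0 mulr1.
  by rewrite segint_cst ?twopi_ge0// mul1r subr0 mulr_gt0// pi_gt0.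
have n0 : 0 < (0 + j.*2 + 2)%:R :> R by rewrite ltr0n addn2.
rewrite -(pmulr_rgt0 _ n0) doubleS wallis_cos_step ?twopi_ge0//.
by rewrite mulr_gt0// ltr0n.
Qed.

Lemma circle_mean_even_power (u v : R) k :
  segint 0 (2 * pi) (fun t => (u + v * cos t) ^+ k.*2) =
  \sum_(j < k.+1) (u ^+ 2) ^+ (k - j) * (v ^+ 2) ^+ j * cos_moment j *+ 'C(k.*2, j.*2).
Proof.
pose c i : R := u ^+ (k.*2 - i) * v ^+ i *+ 'C(k.*2, i).
transitivity (\sum_(i < k.*2.+1) c i * wallis (2 * pi) 0 i).
  rewrite (@eq_segint _ _ _ _ (fun t => \sum_(i < k.*2.+1) c i * (sin t ^+ 0 * cos t ^+ i))); last first.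
    move=> t _; rewrite exprDn; apply: eq_bigr => i _.
    by rewrite /c exprMn expr0 mul1r mulrA mulrnAl.
  rewrite segint_sum; last by move=> i; cont.
  by apply: eq_bigr => i _; rewrite segintZ//; cont.
rewrite (@sum_even_terms _ (fun i => c i * wallis (2 * pi) 0 i)); last first.
  by move=> j; rewrite odd_cos_moment mulr0.
apply: eq_bigr => j _; rewrite /c mulrnAl -doubleB -!mul2n -!exprM.
by rewrite /cos_moment -mul2n.
Qed.

(** Up to a positive factor, [(zonal_symbol k).[sin phi ^+ 2]] is the Legendre
polynomial of degree [2 k] at [cos phi], expanded by Laplace's formula. *)
Definition zonal_symbol k : {poly R} :=
  \sum_(j < k.+1) ((1 - 'X) ^+ (k - j) * 'X ^+ j * ((-1) ^+ j * cos_moment j)%:P) *+ 'C(k.*2, j.*2).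

Lemma zonal_symbol_horner k (s : R) : (zonal_symbol k).[s] =
  \sum_(j < k.+1) ((1 - s) ^+ (k - j) * s ^+ j * ((-1) ^+ j * cos_moment j)) *+ 'C(k.*2, j.*2).
Proof.
rewrite /zonal_symbol horner_sum; apply: eq_bigr => j _.
by rewrite hornerMn !hornerM !horner_exp hornerC !hornerE.
Qed.

(** At [phi = pi / 2], the equator, only the last term of Laplace's formula remains:
an even moment of the cosine. *)
Lemma zonal_symbol_1 k : (zonal_symbol k).[1] != 0.
Proof.
rewrite zonal_symbol_horner big_ord_recr /= big1 ?add0r.
  by rewrite subnn expr0 expr1n binn mulr1n !mul1r mulf_neq0 ?signr_eq0// gt_eqF// cos_moment_gt0.
move=> j _; rewrite subrr expr0n subn_eq0 leqNgt ltn_ord/= mul0r mul0r.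
by rewrite mul0rn.
Qed.

(** If the moments below [k] vanish then, in degree at most [k], [1 - t ^+ 2] acts as
[- t ^+ 2]. *)
Lemma moments_shift H k : continuous H ->
  (forall i, (i < k)%N -> segint (-1) 1 (fun t => (t ^+ 2) ^+ i * H t) = 0) ->
  forall i j, (i + j <= k)%N ->
  segint (-1) 1 (fun t => (t ^+ 2) ^+ i * (1 - t ^+ 2) ^+ j * H t) =
  (-1) ^+ j * segint (-1) 1 (fun t => (t ^+ 2) ^+ (i + j) * H t).
Proof.
move=> cH mH i j; elim: j i => [|j IHj] i ijk.
  by rewrite mul1r addn0; apply: eq_segint => t _; rewrite expr0 mulr1.
rewrite (@eq_segint _ _ _ _ (fun t => (t ^+ 2) ^+ i * (1 - t ^+ 2) ^+ j * H t -
    (t ^+ 2) ^+ i.+1 * (1 - t ^+ 2) ^+ j * H t)); last first.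
  by move=> t _; rewrite !exprS; ring.
rewrite segintB; [|by cont|by cont].
rewrite !IHj ?addSnnS//; last by rewrite (leq_trans _ ijk)// leq_add2l.
by rewrite mH ?mulr0 ?sub0r ?exprS ?mulN1r ?mulNr// -addnS.
Qed.

(** The circular mean of [t ^+ k.*2] is a polynomial in [t ^+ 2] of degree [k];
against a function without moments below [k] only its leading coefficient
counts. *)
Lemma zonal_triangular H k phi : continuous H ->
  (forall i, (i < k)%N -> segint (-1) 1 (fun t => (t ^+ 2) ^+ i * H t) = 0) ->
  segint 0 pi (fun b => sin b * (H (cos b) * segint 0 (2 * pi) (fun t =>
    (cos b * cos phi + sin b * sin phi * cos t) ^+ k.*2))) =
  (zonal_symbol k).[sin phi ^+ 2] * segint (-1) 1 (fun t => (t ^+ 2) ^+ k * H t).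
Proof.
move=> cH mH.
pose c j : R := (cos phi ^+ 2) ^+ (k - j) * (sin phi ^+ 2) ^+ j * cos_moment j *+ 'C(k.*2, j.*2).
pose S x := \sum_(j < k.+1) c j * ((x ^+ 2) ^+ (k - j) * (1 - x ^+ 2) ^+ j * H x).
have cS : continuous S by rewrite /S; cont.
rewrite (@eq_segint _ _ _ _ (fun b => sin b * S (cos b))); last first.
  move=> b _; rewrite circle_mean_even_power mulr_sumr; congr (_ * _).
  rewrite /S; apply: eq_bigr => j _; rewrite /c -sin2cos2 !exprMn mulrnAr mulrnAl.
  by congr (_ *+ _); ring.
rewrite (segint_cos cS) /S segint_sum; last by move=> j; cont.
rewrite zonal_symbol_horner mulr_suml; apply: eq_bigr => j _.
have jk : (j <= k)%N by rewrite -ltnS.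
rewrite segintZ; last by cont.
rewrite (moments_shift cH mH) ?subnK// /c cos2sin2 !mulrnAl; congr (_ *+ _); ring.
Qed.

End Zonal.

(** * Uniqueness for zonal functions *)

Section Radius.
Context {R : realType}.
Implicit Types u rho : R.

(** The norm of the points of the lemon surface at colatitude [phi] depends on [r]
and [phi] through [u := r * sin phi] only: it is the positive root of
[rho ^+ 2 + 2 * u * rho = 1]. *)
Definition lemon_radius u : R := Num.sqrt (u ^+ 2 + 1) - u.

Lemma spindle_radiusE r phi : spindle_radius r phi = lemon_radius (r * sin phi).
Proof. by rewrite /spindle_radius /lemon_radius exprMn. Qed.

Lemma lemon_radius_gt0 u : 0 < lemon_radius u.
Proof.
rewrite /lemon_radius subr_gt0; have [u0|u0] := ltP u 0.
  by rewrite (lt_le_trans u0)// sqrtr_ge0.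
rewrite -{1}(ger0_norm u0) -sqrtr_sqr ltr_sqrt ?ltrDl//.
by rewrite ltr_wpDl// sqr_ge0.
Qed.

Lemma lemon_radius_eq u : lemon_radius u ^+ 2 + 2 * u * lemon_radius u = 1.
Proof.
have h : 0 <= u ^+ 2 + 1 by rewrite addr_ge0 ?sqr_ge0.
have := sqr_sqrtr h; rewrite /lemon_radius; set s := Num.sqrt _ => e; ring: e.
Qed.

Lemma lemon_root_lt u v rho sigma : 0 < rho -> 0 < sigma ->
  rho ^+ 2 + 2 * u * rho = 1 -> sigma ^+ 2 + 2 * v * sigma = 1 ->
  u < v -> sigma < rho.
Proof.
move=> r0 s0 er es uv; rewrite ltNge; apply/negP => rs.
have sv : 0 < sigma + 2 * v.
  rewrite -(pmulr_rgt0 _ s0) (_ : sigma * _ = sigma ^+ 2 + 2 * v * sigma); last by ring.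
  by rewrite es.
have h1 : 0 < (v - u) * rho by rewrite mulr_gt0// subr_gt0.
have h2 : 0 <= rho * (sigma - rho) by rewrite mulr_ge0 ?subr_ge0// ltW.
have h3 : 0 <= (sigma - rho) * (sigma + 2 * v) by rewrite mulr_ge0 ?subr_ge0// ltW.
lra.
Qed.

Lemma lemon_radius_inv rho : 0 < rho ->
  lemon_radius ((1 - rho ^+ 2) / (2 * rho)) = rho.
Proof.
move=> r0; set u := _ / _.
have eu : rho ^+ 2 + 2 * u * rho = 1 by rewrite /u; field; rewrite gt_eqF.
have := lemon_radius_eq u; have := lemon_radius_gt0 u.
set s := lemon_radius u => s0 es.
have su : 0 < s + 2 * u.
  rewrite -(pmulr_rgt0 _ s0) (_ : s * _ = s ^+ 2 + 2 * u * s); last by ring.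
  by rewrite es.
have : (s - rho) * (s + 2 * u + rho) = 0.
  rewrite (_ : (s - rho) * _ = (s ^+ 2 + 2 * u * s) - (rho ^+ 2 + 2 * u * rho)); last by ring.
  by rewrite es eu subrr.
move=> /eqP; rewrite mulf_eq0 => /orP[|]; first by rewrite subr_eq0 => /eqP.
by rewrite gt_eqF// addr_gt0.
Qed.

Lemma cont_lemon_radius : continuous lemon_radius.
Proof. by rewrite /lemon_radius; cont. Qed.

End Radius.

Section ZonalUniqueness.
Context {R : realType}.

Definition spindle_weight (r phi : R) : R :=
  spindle_radius r phi ^+ 2 * sin phi *
  Num.sqrt ((1 + r ^+ 2) / (1 + r ^+ 2 * sin phi ^+ 2)).

Lemma spindle_weightE r phi : spindle_weight r phi =
  Num.sqrt (1 + r ^+ 2) * (sin phi * (lemon_radius (r * sin phi) ^+ 2 *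
    (Num.sqrt (1 + (r * sin phi) ^+ 2))^-1)).
Proof.
rewrite /spindle_weight spindle_radiusE sqrtrM; last by rewrite addr_ge0// sqr_ge0.
have h : 0 <= 1 + r ^+ 2 * sin phi ^+ 2 by rewrite -exprMn addr_ge0// sqr_ge0.
by rewrite exprMn sqrtrV//; ring.
Qed.

Lemma sqrt1D_neq0 (u : R) : Num.sqrt (1 + u ^+ 2) != 0.
Proof. by rewrite gt_eqF// sqrtr_gt0 ltr_pwDl// sqr_ge0. Qed.

Lemma cont_spindle_weight (r : R) : continuous (spindle_weight r).
Proof.
have -> : spindle_weight r = fun phi => Num.sqrt (1 + r ^+ 2) *
    (sin phi * (lemon_radius (r * sin phi) ^+ 2 *
      (Num.sqrt (1 + (r * sin phi) ^+ 2))^-1)).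
  by apply/funext => phi; exact: spindle_weightE.
have cl := @cont_lemon_radius R.
have ci : continuous (fun phi : R => (Num.sqrt (1 + (r * sin phi) ^+ 2))^-1).
  by apply: cont_inv => [phi|]; [exact: sqrt1D_neq0|cont].
by cont.
Qed.

(** By strong induction on [k], the moment [g k] of [K rho] vanishes for all
[rho > eps].  Multiplying the data by [sin b * cos b ^+ k.*2], integrating in [b]
and moving the circular means to the power gives the equation of
[abel_injective] for [g k] in the variable [u] of [lemon_radius]. *)
Theorem zonal_uniqueness (K : R -> R -> R) (eps eps2 : R) :
  0 < eps -> 0 < eps2 < 1 ->
  continuous (fun z : R * R => K z.1 z.2) ->
  (forall rho t, eps2 <= rho -> K rho t = 0) ->
  (forall r b, 0 <= r <= (1 - eps ^+ 2) / (2 * eps) -> 0 <= b <= pi ->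
    segint 0 pi (fun phi => spindle_weight r phi *
      segint 0 (2 * pi) (fun t => K (spindle_radius r phi)
        (cos b * cos phi - sin b * sin phi * cos t))) = 0) ->
  forall rho, eps < rho -> K rho 1 + K rho (-1) = 0.
Proof.
move=> e0 /andP[e20 e21] cK K0 HK.
set delta := _ / _ in HK.
have edelta : eps ^+ 2 + 2 * delta * eps = 1 by rewrite /delta; field; rewrite gt_eqF.
have cl := @cont_lemon_radius R.
pose g k rho := segint (-1) 1 (fun t => (t ^+ 2) ^+ k * K rho t).
have cg k : continuous (g k) by rewrite /g; cont.
pose u0 := (1 - eps2 ^+ 2) / (2 * eps2).
have u00 : 0 < u0.
  rewrite divr_gt0 ?mulr_gt0// subr_gt0 exprn_ilt1 ?(ltW e20)//.
have lu0 u : u <= u0 -> eps2 <= lemon_radius u.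
  rewrite le_eqVlt => /orP[/eqP ->|uu]; first by rewrite lemon_radius_inv.
  apply/ltW; apply: (lemon_root_lt (lemon_radius_gt0 u) e20 (lemon_radius_eq u) _ uu).
  by rewrite /u0; field; rewrite gt_eqF.
have ldelta u : u < delta -> eps < lemon_radius u.
  exact: (lemon_root_lt (lemon_radius_gt0 u) e0 (lemon_radius_eq u) edelta).
have gk k rho : eps < rho -> g k rho = 0.
  elim/ltn_ind: k rho => k IHk rho erho.
  pose q u := lemon_radius u ^+ 2 * (Num.sqrt (1 + u ^+ 2))^-1 * g k (lemon_radius u).
  have ci : continuous (fun u : R => (Num.sqrt (1 + u ^+ 2))^-1).
    by apply: cont_inv => [u|]; [exact: sqrt1D_neq0|cont].
  have cgk := cg k.
  have cq : continuous q by rewrite /q; cont.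
  have q0 u : u <= u0 -> q u = 0.
    move=> uu; rewrite /q /g (@eq_segint _ _ _ _ (fun=> 0)); last first.
      by move=> t _; rewrite K0 ?mulr0// lu0.
    by rewrite segint_cst ?mul0r ?mulr0//; lra.
  pose u := (1 - rho ^+ 2) / (2 * rho).
  have rho0 : 0 < rho by exact: lt_trans erho.
  have lu : lemon_radius u = rho by exact: lemon_radius_inv.
  have ud : u < delta.
    have eu := lemon_radius_eq u; rewrite lu in eu.
    case: (ltgtP u delta) => // [du|du].
      by have := lt_trans erho (lemon_root_lt e0 rho0 edelta eu du); rewrite ltxx.
    by move: erho; rewrite -lu du lemon_radius_inv ?ltxx.
  suff : q u = 0.
    rewrite /q lu => /eqP; rewrite !mulf_eq0 (gt_eqF rho0)/= invr_eq0.
    by rewrite (negbTE (sqrt1D_neq0 u)) => /eqP.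
  (* A segment that ends strictly before [delta], so that all the radii exceed [eps]. *)
  have [u_mid mid_delta] : u < (u + delta) / 2 /\ (u + delta) / 2 < delta by split; lra.
  apply: (abel_injective (zonal_symbol_1 k) cq u00 q0 _ u_mid) => r /andP[r0 rmid].
  have rd : r < delta by exact: le_lt_trans mid_delta.
  have cw := @cont_spindle_weight r.
  have csr : continuous (spindle_radius r).
    by rewrite /spindle_radius; cont.
  have : segint 0 pi (fun b => sin b * (cos b ^+ 2) ^+ k *
     segint 0 pi (fun phi => spindle_weight r phi *
      segint 0 (2 * pi) (fun t => K (spindle_radius r phi)
        (cos b * cos phi - sin b * sin phi * cos t)))) = 0.
    rewrite (@eq_segint _ _ _ _ (fun=> 0)); first by rewrite segint_cst ?pi_ge0// mul0r.
    by move=> b bpi; rewrite HK ?mulr0// r0 ltW.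
  rewrite (@eq_segint _ _ _ _ (fun b => segint 0 pi (fun phi => sin b * (cos b ^+ 2) ^+ k *
     (spindle_weight r phi * segint 0 (2 * pi) (fun t => K (spindle_radius r phi)
        (cos b * cos phi - sin b * sin phi * cos t)))))); last first.
    by move=> b _; rewrite segintZ//; cont.
  rewrite segint_swap ?pi_ge0//; last by cont.
  rewrite (@eq_segint _ _ _ _ (fun phi => Num.sqrt (1 + r ^+ 2) *
     (sin phi * ((zonal_symbol k).[sin phi ^+ 2] * q (r * sin phi))))); last first.
    move=> phi phipi; have cKr : continuous (K (spindle_radius r phi)) by cont.
    have rphi : eps < spindle_radius r phi.
      rewrite spindle_radiusE; apply: ldelta; apply: le_lt_trans rd.
      by rewrite ler_piMr// sin_le1.
    rewrite (@eq_segint _ _ _ _ (fun b => spindle_weight r phi *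
      (sin b * ((fun x => x ^+ k.*2) (cos b) * segint 0 (2 * pi) (fun t => K (spindle_radius r phi)
        (cos b * cos phi - sin b * sin phi * cos t)))))); last first.
      by move=> b _; rewrite -exprM mul2n; ring.
    rewrite segintZ; last by cont.
    rewrite (zonal_mean_adjoint (psi := fun x => x ^+ k.*2) _ cKr phipi); last by cont.
    rewrite (zonal_triangular (k := k))//; last first.
      by move=> i ik; exact: IHk.
    rewrite spindle_weightE -!spindle_radiusE /q -/(g k _) spindle_radiusE; ring.
  rewrite segintZ; last by cont.
  by move=> /eqP; rewrite mulf_eq0 (negbTE (sqrt1D_neq0 r)) => /eqP.
move=> rho erho; apply: even_moments_eq0 => [|k]; first by cont.
exact: gk.
Qed.

End ZonalUniqueness.

(** * Polar coordinates and orthogonal matrices *)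

Section PlanePolar.
Context {R : realType}.
Implicit Types (f : R -> R) (a b c x y z : R).

Lemma segint_periodic_opp (p : R) f : 0 <= p -> continuous f ->
  (forall x, f (x + p) = f x) -> segint 0 p (fun x => f (- x)) = segint 0 p f.
Proof.
move=> p0 cf fp.
have -> : segint 0 p (fun x => f (- x)) = segint (- p) 0 f.
  rewrite /segint /Rintegral; congr fine.
  have := @integration_by_substitution_oppr R f 0 p p0.
  by rewrite oppr0 => ->//; exact: continuous_subspaceT.
have np0 : - p <= 0 by rewrite oppr_le0.
transitivity (segint (- p) 0 (fun x => f (x + p))).
  by apply: eq_segint => x _.
by rewrite segint_shift// addNr add0r.
Qed.

Lemma circle_angle c s : c ^+ 2 + s ^+ 2 = 1 ->
  exists2 t, 0 <= t <= 2 * pi & c = cos t /\ s = sin t.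
Proof.
move=> cs1; have c1 : -1 <= c <= 1.
  by rewrite -ler_norml -(@expr_le1 _ 2)// real_normK ?num_real// -cs1 lerDl sqr_ge0.
have ac := acos_ge0 c1; have ap := acos_lepi c1.
have cac : cos (acos c) = c by rewrite acosK// in_itv.
have sac : sin (acos c) = `|s|.
  by rewrite sin_acos// -cs1 addrAC subrr add0r sqrtr_sqr.
have [s0|s0] := leP 0 s.
  exists (acos c); last by rewrite cac sac ger0_norm.
  by rewrite ac/=; lra.
exists (2 * pi - acos c); first by lra.
have e : 2 * pi = pi *+ 2 :> R by rewrite mulr_natl.
rewrite cosB sinB e cos2pi sin2pi cac sac ltr0_norm//; split; ring.
Qed.

Lemma plane_polar x y : exists2 t, 0 <= t <= 2 * pi &
  x = Num.sqrt (x ^+ 2 + y ^+ 2) * cos t /\ y = Num.sqrt (x ^+ 2 + y ^+ 2) * sin t.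
Proof.
set s := Num.sqrt _; have h : 0 <= x ^+ 2 + y ^+ 2 by rewrite addr_ge0 ?sqr_ge0.
have s2 : s ^+ 2 = x ^+ 2 + y ^+ 2 by exact: sqr_sqrtr.
have [s0|s0] := eqVneq s 0.
  exists 0; first by rewrite lexx twopi_ge0.
  move: s2; rewrite s0 expr0n /= => /esym/eqP.
  by rewrite paddr_eq0 ?sqr_ge0// !sqrf_eq0 => /andP[/eqP -> /eqP ->]; rewrite !mul0r.
have [|t t2 [ct st]] := @circle_angle (x / s) (y / s).
  by rewrite !expr_div_n -mulrDl -s2 divff// expf_neq0.
by exists t => //; rewrite -ct -st; split; rewrite mulrC divfK.
Qed.

End PlanePolar.

Section Vectors.
Context {R : realType}.
Implicit Types (a b c x y z t : R) (v : 'cV[R]_3) (h N : 'M[R]_3).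

Lemma sum3 (F : 'I_3 -> R) : \sum_(i < 3) F i = F 0 + F 1 + F 2%:R.
Proof.
rewrite !big_ord_recl big_ord0 addr0 addrA.
by congr (_ + F _ + F _); apply: val_inj.
Qed.

Lemma ord3P (P : 'I_3 -> Prop) : P 0 -> P 1 -> P 2%:R -> forall i, P i.
Proof.
move=> P0 P1 P2 [[|[|[|//]]] Hi].
- by rewrite (_ : Ordinal Hi = 0)//; exact: val_inj.
- by rewrite (_ : Ordinal Hi = 1)//; exact: val_inj.
- by rewrite (_ : Ordinal Hi = 2%:R)//; exact: val_inj.
Qed.

Lemma vec3_eta v : v = vec3 (v 0 0) (v 1 0) (v 2%:R 0).
Proof. by apply/colP; apply: ord3P; rewrite mxE. Qed.

Lemma mulmx_vec3 h x y z : h *m vec3 x y z =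
  vec3 (h 0 0 * x + h 0 1 * y + h 0 2%:R * z)
       (h 1 0 * x + h 1 1 * y + h 1 2%:R * z)
       (h 2%:R 0 * x + h 2%:R 1 * y + h 2%:R 2%:R * z).
Proof. by apply/colP; apply: ord3P; rewrite !mxE sum3 !mxE. Qed.

Lemma rotU_vec3 a x y z : rotU a *m vec3 x y z =
  vec3 (cos a * x - sin a * y) (sin a * x + cos a * y) z.
Proof. by rewrite mulmx_vec3 !mxE /=; congr vec3; ring. Qed.

Lemma rotV_vec3 b x y z : rotV b *m vec3 x y z =
  vec3 (cos b * x + sin b * z) y (cos b * z - sin b * x).
Proof. by rewrite mulmx_vec3 !mxE /=; congr vec3; ring. Qed.

Lemma enorm_vec3 x y z : enorm (vec3 x y z) = Num.sqrt (x ^+ 2 + y ^+ 2 + z ^+ 2).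
Proof. by rewrite /enorm sum3 !mxE. Qed.

Lemma cont_vec3 : continuous (fun p : R * R * R => vec3 p.1.1 p.1.2 p.2 : 'cV[R]_3).
Proof.
have -> : (fun p : R * R * R => vec3 p.1.1 p.1.2 p.2) =
    (fun p => p.1.1 *: vec3 1 0 0 + p.1.2 *: vec3 0 1 0 + p.2 *: vec3 0 0 1).
  apply/funext => p; apply/colP; apply: ord3P; rewrite !mxE /=; ring.
have c1 : continuous (fun p : R * R * R => p.1.1) by cont.
have c2 : continuous (fun p : R * R * R => p.1.2) by cont.
have c3 : continuous (fun p : R * R * R => p.2) by cont.
move=> p; apply: cvgD; [apply: cvgD|]; apply: cvgZr_tmp.
- exact: c1.
- exact: c2.
- exact: c3.
Qed.

Lemma cont_mulmx_vec3 (g : 'cV[R]_3 -> R) h : continuous g ->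
  continuous (fun p : R * R * R => g (h *m vec3 p.1.1 p.1.2 p.2)).
Proof.
move=> cg p.
have -> : (fun p : R * R * R => g (h *m vec3 p.1.1 p.1.2 p.2)) =
    (fun p => g (vec3 (h 0 0 * p.1.1 + h 0 1 * p.1.2 + h 0 2%:R * p.2)
       (h 1 0 * p.1.1 + h 1 1 * p.1.2 + h 1 2%:R * p.2)
       (h 2%:R 0 * p.1.1 + h 2%:R 1 * p.1.2 + h 2%:R 2%:R * p.2))).
  by apply/funext => q; rewrite mulmx_vec3.
have cgv : continuous (fun q : R * R * R => (fun x y z => g (vec3 x y z)) q.1.1 q.1.2 q.2).
  by move=> q; apply: (@continuous_comp _ _ _ (fun q : R * R * R => vec3 q.1.1 q.1.2 q.2) g);
    [exact: cont_vec3|exact: cg].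
by apply: (@cont_comp3 _ _ _ _ _ (fun x y z => g (vec3 x y z))) => //; cont.
Qed.

Definition orthonormal_columns h := h^T *m h = 1%:M.

Lemma orthonormal_mul h N : orthonormal_columns h -> orthonormal_columns N -> orthonormal_columns (h *m N).
Proof.
rewrite /orthonormal_columns => oh oN.
by rewrite trmx_mul mulmxA -[_ *m _ *m h]mulmxA oh mulmx1.
Qed.

Lemma orthonormal_tr h : orthonormal_columns h -> orthonormal_columns h^T.
Proof. by rewrite /orthonormal_columns trmxK => /mulmx1C. Qed.

Lemma rotU_orthonormal a : orthonormal_columns (rotU a).
Proof.
have e := sin2cos2 a.
apply/matrixP; apply: ord3P; apply: ord3P; rewrite !mxE sum3 !mxE /=; ring: e.
Qed.

Lemma rotV_orthonormal a : orthonormal_columns (rotV a).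
Proof.
have e := sin2cos2 a.
apply/matrixP; apply: ord3P; apply: ord3P; rewrite !mxE sum3 !mxE /=; ring: e.
Qed.

Lemma rotation_orthonormal a b : orthonormal_columns (rotation a b).
Proof. exact: orthonormal_mul (rotU_orthonormal a) (rotV_orthonormal b). Qed.

Lemma sphere_polar x y z : x ^+ 2 + y ^+ 2 + z ^+ 2 = 1 ->
  exists a b, [/\ 0 <= a <= 2 * pi, 0 <= b <= pi & vec3 x y z = polar_point 1 a b].
Proof.
move=> n1; have z1 : -1 <= z <= 1.
  rewrite -ler_norml -(@expr_le1 _ 2)// real_normK ?num_real// -n1 lerDr.
  by rewrite addr_ge0 ?sqr_ge0.
have [a a2 [xa ya]] := plane_polar x y.
have e : Num.sqrt (x ^+ 2 + y ^+ 2) = sin (acos z).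
  by rewrite sin_acos//; congr Num.sqrt; rewrite -n1; ring.
exists a, (acos z); split => //; first by rewrite acos_ge0// acos_lepi.
by rewrite /polar_point !mul1r acosK ?in_itv// -e -xa -ya.
Qed.

(** Such a matrix acts on the horizontal plane by a rotation or, if [s = -1], by a
reflection.  Keeping both cases avoids determinants; the integrals over the
longitude are invariant under both. *)
Lemma orthonormal_fix_pole N : orthonormal_columns N -> N *m vec3 0 0 1 = vec3 0 0 1 ->
  exists c s, [/\ 0 <= c <= 2 * pi, s = 1 \/ s = -1 &
    forall rho t phi, N *m polar_point rho t phi = polar_point rho (c + s * t) phi].
Proof.
move=> oN; rewrite mulmx_vec3 => /colP e.
have := e 0; have := e 1; have := e 2%:R.
rewrite !mxE /= !mulr0 !add0r !mulr1 => n22 n12 n02 {e}.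
have oT := orthonormal_tr oN; rewrite /orthonormal_columns trmxK in oT.
have kl := congr1 (fun M : 'M[R]_3 => M 2%:R 2%:R) oT.
have aa := congr1 (fun M : 'M[R]_3 => M 0 0) oN.
have bb := congr1 (fun M : 'M[R]_3 => M 1 1) oN.
have ab := congr1 (fun M : 'M[R]_3 => M 0 1) oN.
move: kl aa bb ab; rewrite !mxE !sum3 !mxE /= n22.
set a := N 0 0; set b := N 0 1; set c := N 1 0; set d := N 1 1.
set k := N 2%:R 0; set l := N 2%:R 1 => kl aa bb ab.
have [k0 l0] : k = 0 /\ l = 0.
  have /eqP : k ^+ 2 + l ^+ 2 = 0 by move: kl; lra.
  by rewrite paddr_eq0 ?sqr_ge0// !sqrf_eq0 => /andP[/eqP -> /eqP ->].
move: aa bb ab; rewrite k0 l0 => aa bb ab.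
have aa' : a ^+ 2 + c ^+ 2 = 1 by move: aa; lra.
(* The determinant of the horizontal block, hence [1] or [-1]. *)
pose s := a * d - b * c.
have ab' : a * b = - (c * d) by move: ab; lra.
have bE : b = - (s * c).
  have h1 : c * c = 1 - a * a by move: aa; lra.
  rewrite /s; transitivity (b * (a * a + c * c)); first by rewrite h1; ring.
  rewrite mulrDr mulrA [b * a]mulrC ab'; ring.
have dE : d = s * a.
  have h1 : c * c = 1 - a * a by move: aa; lra.
  rewrite /s; transitivity (d * (a * a + c * c)); first by rewrite h1; ring.
  rewrite mulrBl -[b * c * a]mulrA [c * a]mulrC mulrA [b * a]mulrC ab'; ring.
have ss : s * s = 1.
  have : s * s * (a ^+ 2 + c ^+ 2) = 1 by move: bb; rewrite bE dE; lra.
  by rewrite aa' mulr1.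
have [t t2 [ct st]] := circle_angle aa'.
exists t, s; split => //.
  have /eqP : (s - 1) * (s + 1) = 0 by rewrite mulrDr mulrBl ss; ring.
  by rewrite mulf_eq0 subr_eq0 addr_eq0 => /orP[] /eqP ->; [left|right].
move=> rho u phi; rewrite /polar_point mulmx_vec3 n22 n12 n02 -/a -/b -/c -/d -/k -/l.
rewrite k0 l0 bE dE ct st.
have [cs sn] : cos (t + s * u) = cos t * cos u - s * (sin t * sin u) /\
    sin (t + s * u) = sin t * cos u + s * (cos t * sin u).
  have /eqP : (s - 1) * (s + 1) = 0 by rewrite mulrDr mulrBl ss; ring.
  rewrite mulf_eq0 subr_eq0 addr_eq0 => /orP[] /eqP ->.
    by rewrite !mul1r cosD sinD.
  by rewrite !mulN1r cosD sinD cosN sinN; split; ring.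
by rewrite cs sn; congr vec3; ring.
Qed.

Lemma orthonormal_euler h : orthonormal_columns h -> exists al be c s,
  [/\ 0 <= al <= 2 * pi, 0 <= be <= pi, 0 <= c <= 2 * pi, s = 1 \/ s = -1 &
    forall rho t phi, h *m polar_point rho t phi =
      rotation al be *m polar_point rho (c + s * t) phi].
Proof.
move=> oh.
have [x [y [z hz]]] : exists x y z, h *m vec3 0 0 1 = vec3 x y z.
  by rewrite mulmx_vec3; do 3 eexists.
have n1 : x ^+ 2 + y ^+ 2 + z ^+ 2 = 1.
  have : (h *m vec3 0 0 1)^T *m (h *m vec3 0 0 1) = (vec3 0 0 1)^T *m vec3 0 0 1.
    by rewrite trmx_mul mulmxA -[_ *m _ *m h]mulmxA oh mulmx1.
  by rewrite hz => /matrixP /(_ 0 0); rewrite !mxE !sum3 !mxE /=; lra.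
have [al [be [hal hbe xyz]]] := sphere_polar n1.
have oR := rotation_orthonormal al be.
have oRT := orthonormal_tr oR.
have RRT : rotation al be *m (rotation al be)^T = 1%:M.
  by move: oRT; rewrite /orthonormal_columns trmxK.
have Npole : ((rotation al be)^T *m h) *m vec3 0 0 1 = vec3 0 0 1.
  by rewrite -mulmxA hz xyz -rotation_north_pole mulmxA oR mul1mx.
have [c [s [hc hs HN]]] := orthonormal_fix_pole (orthonormal_mul oRT oh) Npole.
exists al, be, c, s; split => // rho t phi.
by rewrite -HN !mulmxA RRT mul1mx.
Qed.

End Vectors.

(** * From the spindle transform to zonal averages *)

Section SpindleReduction.
Context {R : realType}.
Implicit Types (g : 'cV[R]_3 -> R) (h : 'M[R]_3).

Definition lemon_integral (r : R) (F : R -> R -> R -> R) : R :=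
  segint 0 pi (fun phi => spindle_weight r phi * segint 0 (2 * pi) (fun t =>
    F (spindle_radius r phi * sin phi * cos t)
      (spindle_radius r phi * sin phi * sin t)
      (spindle_radius r phi * cos phi))).

Lemma cont_spindle_radius (r : R) : continuous (spindle_radius r).
Proof. by rewrite /spindle_radius; cont. Qed.

Lemma lemon_integralB (r : R) (F G : R -> R -> R -> R) :
  continuous (fun p : R * R * R => F p.1.1 p.1.2 p.2) ->
  continuous (fun p : R * R * R => G p.1.1 p.1.2 p.2) ->
  lemon_integral r (fun x y z => F x y z - G x y z) =
  lemon_integral r F - lemon_integral r G.
Proof.
move=> cF cG; have cw := @cont_spindle_weight R r.
have cr := @cont_spindle_radius r.
rewrite /lemon_integral -segintB; [|by cont|by cont].
by apply: eq_segint => phi _; rewrite -mulrBr -segintB; [|by cont|by cont].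
Qed.

Lemma spindle_lemon_integral g (r al be : R) : continuous g ->
  spindle g r al be =
  lemon_integral r (fun x y z => g (rotation al be *m vec3 x y z)).
Proof.
move=> cg; pose F x y z := g (rotation al be *m vec3 x y z).
have cF : continuous (fun p : R * R * R => F p.1.1 p.1.2 p.2).
  exact: cont_mulmx_vec3.
have cw := @cont_spindle_weight R r.
have cr := @cont_spindle_radius r.
transitivity (segint 0 (2 * pi) (fun t => segint 0 pi (fun phi =>
   spindle_weight r phi * F (spindle_radius r phi * sin phi * cos t)
      (spindle_radius r phi * sin phi * sin t)
      (spindle_radius r phi * cos phi)))); first by [].
rewrite segint_swap ?pi_ge0 ?twopi_ge0//; last by cont.
by apply: eq_segint => phi _; rewrite segintZ//; cont.
Qed.

(** The data only give [h] of the form [rotation al be]; by Euler's decomposition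
the remaining factor of [h] moves the longitude only. *)
Lemma lemon_integral_orthonormal g h (r : R) : continuous g -> orthonormal_columns h ->
  (forall al be, 0 <= al <= 2 * pi -> 0 <= be <= pi -> spindle g r al be = 0) ->
  lemon_integral r (fun x y z => g (h *m vec3 x y z)) = 0.
Proof.
move=> cg oh S0; have [al [be [c [s [hal hbe hc hs E]]]]] := orthonormal_euler oh.
rewrite -(S0 al be hal hbe) (spindle_lemon_integral _ _ _ cg).
apply: eq_segint => phi _; congr (_ * _).
set rho := spindle_radius r phi.
pose F x y z := g (rotation al be *m vec3 x y z).
have cF : continuous (fun p : R * R * R => F p.1.1 p.1.2 p.2).
  exact: cont_mulmx_vec3.
pose f t := F (rho * sin phi * cos t) (rho * sin phi * sin t) (rho * cos phi).
have cf : continuous f by rewrite /f; cont.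
have fp t : f (t + 2 * pi) = f t by rewrite /f mulr_natl sinD2pi cosD2pi.
transitivity (segint 0 (2 * pi) (fun t => f (c + s * t))).
  apply: eq_segint => t _; have := E rho t phi; rewrite /polar_point => ->//.
case: hs => ->.
  rewrite -[RHS](segint_periodic hc cf fp).
  by apply: eq_segint => t _; rewrite mul1r addrC.
rewrite -[RHS](segint_periodic hc cf fp) -[RHS]segint_periodic_opp ?twopi_ge0//.
- by apply: eq_segint => t _; rewrite mulN1r addrC.
- by cont.
- by move=> t; rewrite addrAC fp.
Qed.

(** The integral of [g] over the circle of height [rho * t] on the sphere of radius [rho]
around the axis [h e3].  For [`|t| > 1] the square root is [0], so that the
function is continuous everywhere. *)
Definition zonal_average g h (rho t : R) : R :=
  segint 0 (2 * pi) (fun a => g (h *m vec3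
    (rho * (Num.sqrt (1 - t ^+ 2) * cos a))
    (rho * (Num.sqrt (1 - t ^+ 2) * sin a)) (rho * t))).

Lemma cont_zonal_average g h : continuous g ->
  continuous (fun p : R * R => zonal_average g h p.1 p.2).
Proof.
move=> cg; pose F x y z := g (h *m vec3 x y z).
have cF : continuous (fun p : R * R * R => F p.1.1 p.1.2 p.2).
  exact: cont_mulmx_vec3.
rewrite [X in continuous X](_ : _ = fun p : R * R => segint 0 (2 * pi) (fun a => F
    (p.1 * (Num.sqrt (1 - p.2 ^+ 2) * cos a))
    (p.1 * (Num.sqrt (1 - p.2 ^+ 2) * sin a)) (p.1 * p.2)))//.
by cont.
Qed.

(** The circle may be started at any of its points. *)
Lemma zonal_average_rotation g h (rho x y z : R) : continuous g ->
  x ^+ 2 + y ^+ 2 + z ^+ 2 = 1 ->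
  zonal_average g h rho z = segint 0 (2 * pi) (fun a => g (h *m vec3
    (rho * (cos a * x - sin a * y)) (rho * (sin a * x + cos a * y)) (rho * z))).
Proof.
move=> cg n1; pose F x y z := g (h *m vec3 x y z).
have cF : continuous (fun p : R * R * R => F p.1.1 p.1.2 p.2).
  exact: cont_mulmx_vec3.
have [c hc []] := plane_polar x y.
have -> : x ^+ 2 + y ^+ 2 = 1 - z ^+ 2 by rewrite -n1; ring.
set s := Num.sqrt _ => ex ey.
pose f a := F (rho * (s * cos a)) (rho * (s * sin a)) (rho * z).
have cf : continuous f by rewrite /f; cont.
have fp t : f (t + 2 * pi) = f t by rewrite /f mulr_natl sinD2pi cosD2pi.
rewrite -[LHS](segint_periodic hc cf fp); apply: eq_segint => a _.
rewrite /f /F cosD sinD ex ey; congr (g (_ *m vec3 _ _ _)); ring.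
Qed.

(** Averages over [a] the equations for the axes [h (rotU a) (rotV b) e3]. *)
Lemma zonal_average_transform g h (r b : R) : continuous g -> orthonormal_columns h ->
  (forall al be, 0 <= al <= 2 * pi -> 0 <= be <= pi -> spindle g r al be = 0) ->
  segint 0 pi (fun phi => spindle_weight r phi *
    segint 0 (2 * pi) (fun t => zonal_average g h (spindle_radius r phi)
      (cos b * cos phi - sin b * sin phi * cos t))) = 0.
Proof.
move=> cg oh S0; pose F x y z := g (h *m vec3 x y z).
have cF : continuous (fun p : R * R * R => F p.1.1 p.1.2 p.2).
  exact: cont_mulmx_vec3.
have cw := @cont_spindle_weight R r.
have cr := @cont_spindle_radius r.
(* The coordinates of [rotV b *m polar_point 1 t phi]. *)
pose X (phi t : R) := cos b * sin phi * cos t + sin b * cos phi.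
pose Y (phi t : R) := sin phi * sin t.
pose Z (phi t : R) := cos b * cos phi - sin b * sin phi * cos t.
pose E phi t a := F (spindle_radius r phi * (cos a * X phi t - sin a * Y phi t))
   (spindle_radius r phi * (sin a * X phi t + cos a * Y phi t)) (spindle_radius r phi * Z phi t).
have cE : continuous (fun p : R * R * R => E p.1.1 p.1.2 p.2).
  by rewrite /E /X /Y /Z; cont.
transitivity (segint 0 pi (fun phi => segint 0 (2 * pi) (fun a =>
    spindle_weight r phi * segint 0 (2 * pi) (fun t => E phi t a)))).
  apply: eq_segint => phi _; rewrite segintZ; last by cont.
  apply: (congr1 (fun u => spindle_weight r phi * u)).
  rewrite segint_swap; [|exact: twopi_ge0|exact: twopi_ge0|by cont].
  apply: eq_segint => t _; apply: zonal_average_rotation => //.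
  have e1 := sin2cos2 b; have e2 := sin2cos2 phi; have e3 := sin2cos2 t.
  by rewrite /X /Y /Z; ring: e1 e2 e3.
rewrite segint_swap ?twopi_ge0 ?pi_ge0//; last by cont.
rewrite (@eq_segint _ _ _ _ (fun=> 0)); first by rewrite segint_cst ?mul0r ?twopi_ge0.
move=> a _.
rewrite -[RHS](lemon_integral_orthonormal cg (orthonormal_mul oh (rotation_orthonormal a b)) S0).
apply: eq_segint => phi _; congr (_ * _); apply: eq_segint => t _.
rewrite /E /F /rotation -!mulmxA rotV_vec3 rotU_vec3.
congr (g (_ *m vec3 _ _ _)); rewrite /X /Y /Z; ring.
Qed.

End SpindleReduction.

(** * Uniqueness for the spindle transform *)

Section Final.
Context {R : realType}.

Lemma enorm_orthonormal (h : 'M[R]_3) v : orthonormal_columns h ->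
  enorm (h *m v) = enorm v.
Proof.
have enormE (w : 'cV[R]_3) : enorm w = Num.sqrt ((w^T *m w) 0 0).
  by rewrite /enorm mxE; congr Num.sqrt; apply: eq_bigr => i _; rewrite mxE expr2.
by move=> oh; rewrite !enormE trmx_mul mulmxA -[_ *m _ *m h]mulmxA oh mulmx1.
Qed.

Lemma enormZ (s : R) v : 0 <= s -> enorm (s *: v) = s * enorm v.
Proof.
move=> s0; rewrite [v]vec3_eta /enorm !sum3 !mxE /= !exprMn -!mulrDr.
by rewrite sqrtrM ?sqr_ge0// sqrtr_sqr ger0_norm.
Qed.

Lemma closed_support_eq0 (f : 'cV[R]_3 -> R) Omega x :
  test_function Omega f -> ~ Omega x -> f x = 0.
Proof.
move=> [_ _ sub] nO; apply/eqP; apply: contrapT => /negP fx; apply: nO.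
by apply: sub; apply: subset_closure.
Qed.

(** Gives the boundary case [enorm x = eps]. *)
Lemma limit_from_right_eq0 (f : R -> R) : continuous f ->
  (forall s, 1 < s -> f s = 0) -> f 1 = 0.
Proof.
move=> cf f0; have c1 : f x @[x --> 1^'+] --> f 1 by apply: cvg_at_right_filter; exact: cf.
have c2 : f x @[x --> 1^'+] --> (0 : R).
  apply: cvg_near_cst; near=> s; apply: f0; near: s; exact: nbhs_right_gt.
exact: (cvg_unique _ c1 c2).
Unshelve. all: by end_near.
Qed.

End Final.

Theorem corollary1 (R : realType) (eps1 eps2 eps : R)
    (f1 f2 : 'cV[R]_3 -> R) :
  0 < eps1 -> eps1 < eps2 -> eps2 < 1 ->
  eps1 <= eps -> eps <= eps2 ->
  test_function (hollow_ball eps1 eps2 `&` upper_half_space) f1 ->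
  test_function (hollow_ball eps1 eps2 `&` upper_half_space) f2 ->
  (forall r alpha beta : R,
      0 <= r <= (1 - eps ^+ 2) / (2 * eps) ->
      0 <= alpha <= 2 * pi -> 0 <= beta <= pi ->
      spindle f1 r alpha beta = spindle f2 r alpha beta) ->
  forall x : 'cV[R]_3, eps <= enorm x <= 1 -> f1 x = f2 x.
Proof.
move=> e10 e12 e21 e1e ee2 tf1 tf2 S12.
have e0 : 0 < eps by exact: lt_le_trans e1e.
have e20 : 0 < eps2 by exact: lt_trans e12.
have cf1 : continuous f1 by case: tf1 => /(_ 0%N) [].
have cf2 : continuous f2 by case: tf2 => /(_ 0%N) [].
pose g x := f1 x - f2 x.
have cg : continuous g.
  by rewrite /g; cont.
have g0 x : ~ (hollow_ball eps1 eps2 `&` upper_half_space) x -> g x = 0.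
  by move=> nO; rewrite /g (closed_support_eq0 tf1 nO) (closed_support_eq0 tf2 nO) subrr.
have Sg r al be : 0 <= r <= (1 - eps ^+ 2) / (2 * eps) ->
    0 <= al <= 2 * pi -> 0 <= be <= pi -> spindle g r al be = 0.
  move=> hr ha hb; rewrite (spindle_lemon_integral _ _ _ cg).
  rewrite lemon_integralB; [|exact: cont_mulmx_vec3|exact: cont_mulmx_vec3].
  rewrite -(spindle_lemon_integral _ _ _ cf1) -(spindle_lemon_integral _ _ _ cf2).
  by rewrite S12// subrr.
have g_far x : eps2 <= enorm x -> g x = 0.
  move=> ex; apply: g0 => -[/andP[_ xe] _].
  by move: (le_lt_trans ex xe); rewrite ltxx.
have outside x : eps < enorm x -> g x = 0.
  move=> ex; have rho0 : 0 < enorm x by exact: lt_trans ex.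
  set rho := enorm x in ex rho0 *.
  have [al [be [_ _ E]]] : exists al be, [/\ 0 <= al <= 2 * pi, 0 <= be <= pi &
      vec3 (x 0 0 / rho) (x 1 0 / rho) (x 2%:R 0 / rho) = polar_point 1 al be].
    apply: sphere_polar; rewrite !expr_div_n -!mulrDl.
    rewrite /rho /enorm sum3 sqr_sqrtr ?divff//.
      by move: rho0; rewrite /rho /enorm sum3 sqrtr_gt0 => /gt_eqF ->.
    by rewrite !addr_ge0// sqr_ge0.
  pose h := rotation al be.
  have oh : orthonormal_columns h by exact: rotation_orthonormal.
  have xE s : h *m vec3 0 0 (s * rho) = s *: x.
    have -> : vec3 0 0 (s * rho) = (s * rho) *: vec3 0 0 1 :> 'cV[R]_3.
      by apply/colP; apply: ord3P; rewrite !mxE /= ?mulr0 ?mulr1.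
    rewrite -scalemxAr rotation_north_pole -E.
    by apply/colP; apply: ord3P; rewrite !mxE /=; field; rewrite gt_eqF.
  have K0 sigma t : eps2 <= sigma -> zonal_average g h sigma t = 0.
    move=> es; rewrite /zonal_average (@eq_segint _ _ _ _ (fun=> 0)).
      by rewrite segint_cst ?mul0r ?twopi_ge0.
    move=> a _; apply: g_far; rewrite enorm_orthonormal// enorm_vec3.
    apply: (le_trans es); have sigma0 : 0 <= sigma by rewrite (le_trans _ es)// ltW.
    rewrite -{1}(ger0_norm sigma0) -sqrtr_sqr ler_wsqrtr//.
    have e := sin2cos2 a; set s := Num.sqrt _.
    rewrite (_ : _ + _ = sigma ^+ 2 * (s ^+ 2 + t ^+ 2)); last by ring: e.
    rewrite ler_peMr ?sqr_ge0//; have [t1|t1] := leP 0 (1 - t ^+ 2).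
      by rewrite sqr_sqrtr// subrK.
    by rewrite (_ : s = 0) ?expr0n ?add0r; [lra|exact/ler0_sqrtr/ltW].
  have Kpole s : s ^+ 2 = 1 -> zonal_average g h rho s = g (s *: x) * (2 * pi).
    move=> s1; rewrite /zonal_average s1 subrr sqrtr0.
    rewrite (@eq_segint _ _ _ _ (fun=> g (s *: x))).
      by rewrite segint_cst ?subr0 ?twopi_ge0.
    by move=> a _; rewrite !mul0r !mulr0 [rho * s]mulrC xE.
  have /eqP : zonal_average g h rho 1 + zonal_average g h rho (-1) = 0.
    have e2 : 0 < eps2 < 1 by rewrite e20.
    have HK r b : 0 <= r <= (1 - eps ^+ 2) / (2 * eps) -> 0 <= b <= pi ->
        segint 0 pi (fun phi => spindle_weight r phi *
          segint 0 (2 * pi) (fun t => zonal_average g h (spindle_radius r phi)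
            (cos b * cos phi - sin b * sin phi * cos t))) = 0.
      by move=> hr _; apply: zonal_average_transform => // al' be'; exact: Sg.
    exact: (zonal_uniqueness e0 e2 (@cont_zonal_average R g h cg) K0 HK ex).
  rewrite (Kpole 1) ?expr1n// (Kpole (-1)) ?sqrrN ?expr1n// -mulrDl mulf_eq0 orbC gt_eqF/=; last first.
    by rewrite mulr_gt0// pi_gt0.
  rewrite scale1r scaleN1r => /eqP gx.
  have [x2|x2] := leP (x 2%:R 0) 0.
    by apply: g0 => -[_]; rewrite /upper_half_space/= ltNge x2.
  rewrite -gx (g0 (- x)) ?addr0// => -[_]; rewrite /upper_half_space/= mxE oppr_gt0.
  by rewrite ltNge (ltW x2).
move=> x /andP[ex _]; apply/eqP; rewrite -subr_eq0; apply/eqP.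
move: ex; rewrite le_eqVlt => /orP[/eqP ex|]; last exact: outside.
rewrite -[LHS]/(g x) -[x in LHS]scale1r.
apply: (@limit_from_right_eq0 _ (fun s => g (s *: x))).
  move=> s; apply: (@continuous_comp _ _ _ (fun s : R => s *: x) g).
    exact: scalel_continuous.
  exact: cg.
move=> s s1; apply: outside; rewrite enormZ; last by rewrite ltW// (lt_trans ltr01).
by rewrite -ex ltr_pMl.
Qed.
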